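(* Let the time step be $\tau=T/N$ with $N\in\mathbb{N}$, $N\ge 2$. Suppose that $(\boldsymbol{u}_{n+1},p_{n+1})\in [H^1_0(\Omega)]^d\times [L^2_0(\Omega)\cap H^1(\Omega)]$, $n=0,\dots,N-1$, satisfy, starting from the initial velocity $\boldsymbol{u}_0$ and $p_0=p_{-1}=0$, the fractional-step implicit-explicit stress-divergence scheme $$\frac{1}{\tau}(\boldsymbol{u}_{n+1}-\boldsymbol{u}_{n},\boldsymbol{w})+(\nu_{n+1}\nabla\boldsymbol{u}_{n+1},\nabla\boldsymbol{w}) +((\nabla\boldsymbol{u}_{n+1})\boldsymbol{u}_{n},\boldsymbol{w}) + \frac{1}{2}((\nabla\cdot\boldsymbol{u}_n)\boldsymbol{u}_{n+1},\boldsymbol{w}) = (2p_{n}-p_{n-1},\nabla\cdot\boldsymbol{w})-\left(\sqrt{\nu_n}\,\nabla^{\top}\boldsymbol{u}_{n},\sqrt{\nu_{n+1}}\,\nabla\boldsymbol{w}\right) + (\boldsymbol{f}_{n+1},\boldsymbol{w}),$$ $$\tau(\nabla(p_{n+1}-p_{n}),\nabla q) + (q,\nabla\cdot\boldsymbol{u}_{n+1}) = 0,$$ for all $(\boldsymbol{w},q)\in [H^1_0(\Omega)]^d\times [L^2_0(\Omega)\cap H^1(\Omega)]$ and all $n=0,\dots,N-1$. Then $$\|\boldsymbol{u}_{N}\|^2 + \tau\big\| \sqrt{\nu_{N}}\,\nabla\boldsymbol{u}_{N}\big\|^2 + \tau^2\|\nabla p_N\|^2 + \frac{\tau}{T}\sum_{n=1}^{N}\Big(\tau\big\|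 \sqrt{\nu_{n}}\,\nabla\boldsymbol{u}_{n}\big\|^2+\tau^2\|\nabla p_n\|^2\Big) \leq M\Bigg[\|\boldsymbol{u}_{0}\|^2 + \tau\|\sqrt{\nu_0}\,\nabla\boldsymbol{u}_0 \|^2 + T\sum_{n=1}^{N}\tau\|\boldsymbol{f}_{n}\|^2\Bigg],$$ where $$M = \exp\Bigg(\frac{1}{1-\tau/T}\Bigg) = \exp\Bigg(\frac{N}{N-1}\Bigg) \leq \mathrm{e}^2 .$$
   Context: Setting: $\Omega\subset\mathbb{R}^d$, $d=2$ or $3$, is a bounded domain with Lipschitz boundary, $T>0$, and $Q=\Omega\times(0,T]$. The problem discretised in time is the incompressible Navier--Stokes system $\partial_t\boldsymbol{u}+(\nabla\boldsymbol{u})\boldsymbol{u}-\nabla\cdot[2\nu\nabla^{\mathrm{s}}\boldsymbol{u}]+\nabla p=\boldsymbol{f}$, $\nabla\cdot\boldsymbol{u}=0$ in $Q$, $\boldsymbol{u}=\boldsymbol{0}$ on $\partial\Omega\times(0,T]$, $\boldsymbol{u}=\boldsymbol{u}_0$ at $t=0$, where $\nabla^{\mathrm{s}}$ is the symmetric gradient. The viscosity $\nu=\nu(\boldsymbol{x},t)$ is given, with $\nu\ge\nu_{\mathrm{min}}>0$ in $\bar Q$ for a constant $\nu_{\mathrm{min}}$, and is such that all integrals in the scheme and the estimate are well defined and finite. The data satisfy $\boldsymbol{f}\in[L^2(Q)]^d$ and $\boldsymbol{u}_0\in[H^1_0(\Omega)]^d$ with $\nabla\cdot\boldsymbol{u}_0=0$.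 The pressure is initialised with $p_0=0$ (and $p_{-1}=0$, corresponding to an initial end-of-step velocity equal to $\boldsymbol{u}_0$). Notation: $t_n=n\tau$, $\nu_n=\nu(\cdot,t_n)$, $\boldsymbol{f}_n=\boldsymbol{f}(\cdot,t_n)\in[L^2(\Omega)]^d$. $(\cdot,\cdot)$ and $\|\cdot\|$ are the $L^2(\Omega)$ inner product and norm for scalar-, vector- and tensor-valued functions (Euclidean/Frobenius products pointwise). $L^2_0(\Omega)$ is the space of $L^2(\Omega)$ functions with zero mean. $(\nabla\boldsymbol{u})_{ij}=\partial_j u_i$, $\nabla^{\top}\boldsymbol{u}=(\nabla\boldsymbol{u})^{\top}$, and $((\nabla\boldsymbol{w})\boldsymbol{v})_i=\sum_j v_j\partial_j w_i$. *)

(* Defs.v *)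
From HB Require Import structures.
From mathcomp Require Import all_boot all_order all_algebra.
From mathcomp Require Import all_classical all_reals all_analysis.
From mathcomp Require Import measurable_realfun ring lra.

Set Implicit Arguments.
Unset Strict Implicit.
Unset Printing Implicit Defensive.

Import Order.TTheory GRing.Theory Num.Theory.
Import numFieldNormedType.Exports.

Local Open Scope classical_set_scope.
Local Open Scope ring_scope.

Section measurable_rV.
Context {R : realType} (n : nat).

Let coord (i : 'I_n) (x : 'rV[R]_n) : R := x 0 i.

Let rV_set0 : g_sigma_preimage coord set0.
Proof. exact: sigma_algebra0. Qed.

Let rV_setC A : g_sigma_preimage coord A -> g_sigma_preimage coord (~` A).
Proof. exact: sigma_algebraC. Qed.

Let rV_bigcup (F : _^nat) : (forall i, g_sigma_preimage coord (F i)) ->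
  g_sigma_preimage coord (\bigcup_i (F i)).
Proof. exact: sigma_algebra_bigcup. Qed.

HB.instance Definition _ :=
  @isMeasurable.Build (measure_tuple_display default_measure_display)
    'rV[R]_n (g_sigma_preimage coord) rV_set0 rV_setC rV_bigcup.

Lemma measurable_coord (i : 'I_n) :
  measurable_fun [set: 'rV[R]_n] (fun x : 'rV[R]_n => x 0 i).
Proof.
move=> _ Y mY; rewrite setTI; apply: sub_sigma_algebra => /=.
rewrite -bigcup_seq/=; exists i => /=; first by rewrite mem_index_enum.
by exists Y => //; rewrite setTI.
Qed.

Lemma measurable_fun_rV d (T : measurableType d) (f : T -> 'rV[R]_n) :
  (forall i, measurable_fun [set: T] (fun x => f x 0 i)) ->
  measurable_fun [set: T] f.
Proof.
have aux m (g : 'I_m -> T -> R) : (forall i, measurable_fun [set: T] (g i)) ->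
    g_sigma_preimage g `<=` measurable.
  move=> mg; apply: smallest_sub; first exact: sigma_algebra_measurable.
  case: m g mg => [|m] g mg; first by rewrite big_ord0.
  rewrite -bigcup_mkord_ord; apply: bigcup_sub => i Ii.
  by move=> A [B mB <-]; exact: mg.
move=> mf; have := aux _ (fun i => coord i \o f) mf.
rewrite g_sigma_preimage_comp => prefS _ A mA.
by apply: prefS; exists A.
Qed.

Lemma open_measurable_rV (U : set 'rV[R]_n) : open U -> measurable U.
Proof.
move=> oU.
pose box (q : 'rV[rat]_n * rat) : set 'rV[R]_n :=
  \bigcap_(i in [set: 'I_n]) [set x | `|ratr (q.1 0 i) - x 0 i| < ratr q.2].
pose F (k : nat) : set 'rV[R]_n :=
  if @unpickle ('rV[rat]_n * rat)%type k is Some q then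
    if `[< box q `<=` U >] then box q else set0 else set0.
have mbox q : measurable (box q).
  apply: fin_bigcap_measurable => //= i _.
  have mg : measurable_fun [set: 'rV[R]_n]
      (fun x : 'rV[R]_n => `|ratr (q.1 0 i) - x 0 i|).
    apply: measurableT_comp => //; apply: measurable_funB => //.
    exact: measurable_coord.
  have := mg measurableT _ (measurable_itv `]-oo, (ratr q.2 : R)[).
  by rewrite setTI; congr measurable; apply/seteqP; split => x /=;
    rewrite in_itv.
rewrite (_ : U = \bigcup_k F k).
  apply: bigcupT_measurable => k; rewrite /F.
  by case: unpickle => // q; case: ifP.
apply/seteqP; split=> [x Ux|x [k _]]; last first.
  by rewrite /F; case: unpickle => // q; case: ifPn => // /asboolP; exact.
have /nbhs_ballP[e /= e0 xeU] : nbhs x U by exact: open_nbhs_nbhs.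
have [r /andP[r0 re]] : exists r : rat, (0 < ratr r :> R) && (ratr r < e / 2).
  by have := @rat_in_itvoo R 0 (e / 2); rewrite divr_gt0// => /(_ isT)[r];
    rewrite in_itv => ?; exists r.
have /choice[q qP] : forall i, exists s : rat, `|ratr s - x 0 i| < ratr r :> R.
  move=> i; have := @rat_in_itvoo R (x 0 i) (x 0 i + ratr r).
  rewrite ltrDl r0 => /(_ isT)[s]; rewrite in_itv/= => /andP[s1 s2].
  by exists s; rewrite gtr0_norm ?subr_gt0// ltrBlDl.
exists (pickle (\row_i q i, r)) => //; rewrite /F pickleK.
have bU : box (\row_i q i, r) `<=` U.
  move=> y yb; apply: xeU; rewrite -ball_normE/= /Num.norm/=.
  have := yb; rewrite /box/= => {}yb.
  rewrite -[ltLHS]/`|x - y| [ltLHS]mx_normrE.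
  apply/bigmax_ltP; split => //= -[a b] _ /=; rewrite !mxE ord1.
  have := yb b I; rewrite /= mxE; have := qP b.
  rewrite -[(_ - _)]opprB normrN.
  have := ler_distD (ratr (q b)) (x 0 b) (y 0 b).
  rewrite [`|x 0 b - ratr _|]distrC.
  have := re; rewrite ltr_pdivlMr// => re2.
  rewrite ![`|ratr _ - _|]distrC => *; lra.
by case: ifPn => [_ i _ /=|/asboolPn //]; rewrite mxE; exact: qP.
Qed.

End measurable_rV.

Section lebesgue_rV.
Context {R : realType}.

Section step.
Variable n : nat.

Let cons_rV (z : R * 'rV[R]_n) : 'rV[R]_n.+1 :=
  row_mx (const_mx z.1 : 'rV_1) z.2.

Let uncons_rV (x : 'rV[R]_n.+1) : R * 'rV[R]_n :=
  (x 0 ord0, \row_i x 0 (lift ord0 i)).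

Let cons0 z : cons_rV z 0 ord0 = z.1.
Proof. by rewrite /cons_rV mxE; case: splitP => [j _|k //]; rewrite mxE. Qed.

Let consS z i : cons_rV z 0 (lift ord0 i) = z.2 0 i.
Proof.
rewrite /cons_rV mxE; case: splitP => [[[]]//|k]; rewrite lift0 => -[ik].
by congr (z.2 _ _); exact: val_inj.
Qed.

Let cons_rVK : cancel cons_rV uncons_rV.
Proof.
move=> [a v]; rewrite /uncons_rV cons0; congr pair.
by apply/rowP => i; rewrite mxE consS.
Qed.

Let measurable_cons_rV : measurable_fun [set: R * 'rV[R]_n] cons_rV.
Proof.
apply: measurable_fun_rV => i; case: (unliftP ord0 i) => [j|] ->.
  under eq_fun do rewrite consS.
  exact: (measurableT_comp (measurable_coord j) measurable_snd).
by under eq_fun do rewrite cons0; exact: measurable_fst.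
Qed.

Let measurable_uncons_rV : measurable_fun [set: 'rV[R]_n.+1] uncons_rV.
Proof.
apply: measurable_fun_pair; first exact: measurable_coord.
apply: measurable_fun_rV => i; under eq_fun do rewrite mxE.
exact: measurable_coord.
Qed.

Section step_measure.
Variable mu : {sigma_finite_measure set 'rV[R]_n -> \bar R}.

Definition lebesgue_step : set 'rV[R]_n.+1 -> \bar R :=
  pushforward (lebesgue_measure \x mu)%E cons_rV.

Let step0 : lebesgue_step set0 = 0%E.
Proof. by rewrite /lebesgue_step /pushforward preimage_set0 measure0. Qed.

Let step_ge0 A : (0 <= lebesgue_step A)%E.
Proof. exact: measure_ge0. Qed.

Let step_sigma_additive : semi_sigma_additive lebesgue_step.
Proof. exact: measure_semi_sigma_additive. Qed.

HB.instance Definition _ := isMeasure.Build _ _ _ lebesgue_step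
  step0 step_ge0 step_sigma_additive.

Let step_sigma_finite : sigma_finite setT lebesgue_step.
Proof.
have /sigma_finiteP[F [TF ndF Foo]] := sigma_finiteT (@lebesgue_measure R).
have /sigma_finiteP[G [TG ndG Goo]] := sigma_finiteT mu.
exists (fun k => uncons_rV @^-1` (F k `*` G k)).
  apply/seteqP; split=> // x _.
  have : [set: measurableTypeR R] (uncons_rV x).1 by [].
  have : [set: 'rV[R]_n] (uncons_rV x).2 by [].
  rewrite TF TG => -[k _ Gk] [j _ Fj]; exists (maxn j k) => //; split.
    by apply: subsetPset Fj; apply/ndF/leq_maxl.
  by apply: subsetPset Gk; apply/ndG/leq_maxr.
move=> k; have [mFk Fkoo] := Foo k; have [mGk Gkoo] := Goo k; split.
  rewrite -[X in measurable X]setTI; apply: measurable_uncons_rV => //.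
  exact: measurableX.
rewrite /lebesgue_step /pushforward (_ : cons_rV @^-1` _ = F k `*` G k).
  by rewrite product_measure1E// lte_mul_pinfty// ge0_fin_numE.
rewrite -[LHS]/((uncons_rV \o cons_rV) @^-1` _).
by rewrite (_ : _ \o _ = id)//; exact/funext/cons_rVK.
Qed.

HB.instance Definition _ :=
  Measure_isSigmaFinite.Build _ _ _ lebesgue_step step_sigma_finite.

Lemma lebesgue_step_box (A : set R) (B : 'I_n -> set R) :
  measurable A -> measurable [set x : 'rV[R]_n | forall i, B i (x 0 i)] ->
  lebesgue_step [set x | A (x 0 ord0) /\ forall i, B i (x 0 (lift ord0 i))] =
  (lebesgue_measure A * mu [set x : 'rV[R]_n | forall i, B i (x ord0 i)])%E.
Proof.
move=> mA mB; rewrite -product_measure1E// /lebesgue_step /pushforward.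
congr (_ _); apply/seteqP; split => -[a v]/=; rewrite cons0 => -[? vB];
by split => // i; have := vB i; rewrite consS.
Qed.

End step_measure.
End step.

(* n-fold product of the one-dimensional Lebesgue measure, on Borel sets *)
Fixpoint lebesgue_rV (n : nat) :
    {sigma_finite_measure set 'rV[R]_n -> \bar R} :=
  match n with
  | 0%N => dirac (0 : 'rV[R]_0)
  | m.+1 => lebesgue_step (lebesgue_rV m)
  end.

Lemma measurable_box n (B : 'I_n -> set R) : (forall i, measurable (B i)) ->
  measurable [set x : 'rV[R]_n | forall i, B i (x 0 i)].
Proof.
move=> mB; rewrite (_ : [set _ | _] =
    \bigcap_(i in [set: 'I_n]) ((fun x : 'rV[R]_n => x 0 i) @^-1` B i)).
  apply: fin_bigcap_measurable => // i _.
  by rewrite -[X in measurable X]setTI; exact: measurable_coord.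
by apply/seteqP; split => x /= h i; [move=> _; exact: h|exact: h i I].
Qed.

Lemma lebesgue_rV_box n (a b : 'rV[R]_n) : (forall i, a 0 i <= b 0 i) ->
  lebesgue_rV n [set x | forall i, a 0 i <= x 0 i <= b 0 i] =
  (\prod_i (b 0 i - a 0 i))%:E.
Proof.
elim: n a b => [|n IHn] a b ab.
  rewrite big_ord0 /= diracE mem_set// => -[]//.
rewrite big_ord_recl /=.
pose A : set R := `[a 0 ord0, b 0 ord0]%classic.
pose B (i : 'I_n) : set R := `[a 0 (lift ord0 i), b 0 (lift ord0 i)]%classic.
transitivity (lebesgue_step (lebesgue_rV n) [set x : 'rV[R]_n.+1 |
    A (x 0 ord0) /\ forall i, B i (x 0 (lift ord0 i))]).
  congr (_ _); apply/seteqP; split => x /=; rewrite /A /B.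
    by move=> h; split=> [|i]; rewrite /= in_itv/=; exact: h.
  move=> [h0 hS] i; case: (unliftP ord0 i) => [j|] ->.
    by have := hS j; rewrite /= in_itv.
  by move: h0; rewrite /= in_itv.
have mA : measurable A by exact: measurable_itv.
have mB : measurable [set x : 'rV[R]_n | forall i, B i (x 0 i)].
  by apply: measurable_box => i; exact: measurable_itv.
rewrite (lebesgue_step_box (lebesgue_rV n) mA mB).
have := IHn (\row_i a 0 (lift ord0 i)) (\row_i b 0 (lift ord0 i)).
under eq_bigr do rewrite !mxE.
move=> IH; rewrite EFinM; congr (_ * _)%E.
  rewrite lebesgue_measure_itv/= lte_fin lt_neqAle ab andbT.
  case: eqVneq => [->|_] /=; first by rewrite subrr.
  by rewrite EFinB.
rewrite -IH; last by move=> i; rewrite !mxE.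
congr (_ _); apply/seteqP; split => x /= h i; have := h i;
  by rewrite /B /= !mxE in_itv.
Qed.
End lebesgue_rV.

Section domain.
Context {R : realType} {d : nat}.

Definition boundary (Omega : set 'rV[R]_d) := closure Omega `\` interior Omega.

(* Near each boundary point, after a rigid motion [x |-> (x - x0) *m Q], the
   set is the strict epigraph, in the direction of some coordinate [k], of a
   Lipschitz function of the remaining coordinates. *)
Definition lipschitz_boundary (Omega : set 'rV[R]_d) :=
  forall x0, boundary Omega x0 ->
  exists (Q : 'M[R]_d) (k : 'I_d) (gamma : 'rV[R]_d.-1 -> R) (r : R),
    [/\ Q *m Q^T = 1%:M, lipschitz gamma, 0 < r &
        forall x, ball x0 r x ->
          let y := (x - x0) *m Q in
          Omega x <-> gamma (col' k y) < y 0 k].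

End domain.

Record lipschitz_domain (R : realType) (d : nat) := LipschitzDomain {
  domain_set :> set 'rV[R]_d ;
  domain_nonempty : domain_set !=set0 ;
  domain_open : open domain_set ;
  domain_connected : connected domain_set ;
  domain_bounded : bounded_set domain_set ;
  domain_lipschitz : lipschitz_boundary domain_set
}.

Definition in_L2 {disp} {T : measurableType disp} {R : realType}
    (mu : set T -> \bar R) (D : set T) (f : T -> R) :=
  measurable_fun D f /\ mu.-integrable D (fun x => (f x ^+ 2)%:E).

Section test_functions.
Context {R : realType} {d : nat}.

Definition pderiv (i : 'I_d) (f : 'rV[R]_d -> R) : 'rV[R]_d -> R :=
  fun x => 'D_(delta_mx 0 i) f x.

(* class C^oo: differentiability of all the iterated partial derivatives makes
   all of them continuous *)
Definition smooth (f : 'rV[R]_d -> R) :=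
  forall (s : seq 'I_d) x, differentiable (foldr pderiv f s) x.

(* C_c^oo(Omega) *)
Definition test_function (Omega : set 'rV[R]_d) (phi : 'rV[R]_d -> R) :=
  smooth phi /\
  exists K, [/\ compact K, K `<=` Omega & forall x, ~ K x -> phi x = 0].

End test_functions.

Section sobolev.
Context {R : realType} {d : nat}.
Variable Omega : lipschitz_domain R d.
Local Notation V := 'rV[R]_d.
Local Notation leb := (lebesgue_rV d).

Lemma domain_measurable : measurable (Omega : set V).
Proof. by apply: open_measurable_rV; exact: domain_open. Qed.

Lemma domain_finite_measure : (leb Omega < +oo)%E.
Proof.
have [M [Mr bM]] := domain_bounded Omega.
pose a : V := const_mx (- (`|M| + 1)); pose b : V := const_mx (`|M| + 1).
have ab i : a 0 i <= b 0 i.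
  by rewrite !mxE; apply: (@le_trans _ _ 0); rewrite ?oppr_le0 ?addr_ge0.
pose B : set V := [set x | forall i, a 0 i <= x 0 i <= b 0 i].
have mB : measurable B.
  exact: (@measurable_box R d (fun i => `[a 0 i, b 0 i]%classic)
    (fun i => measurable_itv _)).
apply: (@le_lt_trans _ _ (leb B)).
  apply: le_measure; rewrite ?in_setE//; first exact: domain_measurable.
  have M1 : M < `|M| + 1 by rewrite ltr_pwDr// ler_norm.
  move=> x /(bM _ M1) /= xM i; rewrite !mxE -ler_norml; apply: le_trans xM.
  rewrite [leRHS]mx_normrE; apply/bigmax_geP; right.
  by exists (0, i).
by rewrite lebesgue_rV_box// ltry.
Qed.

Lemma continuous_in_L2 (f : V -> R) : continuous f -> in_L2 leb Omega f.
Proof.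
move=> cf.
have mf : measurable_fun (Omega : set V) f.
  apply: measurable_funTS; apply: (measurability _ (RGenOInfty.measurableE R)).
  move=> /= _ [_ [a ->] <-]; rewrite setTI; apply: open_measurable_rV.
  by apply: open_comp => //; exact: interval_open.
split => //; apply: measurable_bounded_integrable.
- exact: domain_measurable.
- exact: domain_finite_measure.
- exact: measurable_funX.
have [M [Mr bM]] := domain_bounded Omega.
have cK : compact (closed_ball (0 : V) (`|M| + 1)).
  apply: bounded_closed_compact; last exact: closed_ball_closed.
  exists (`|M| + 1); split; first exact: num_real.
  move=> z Mz x; rewrite closed_ballE ?ltr_pwDr// /closed_ball_/= sub0r normrN.
  by move=> /le_trans; apply; exact: ltW.
have /compact_bounded[C [Cr bC]] :
    compact ((fun x => f x ^+ 2) @` closed_ball (0 : V) (`|M| + 1)).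
  apply: continuous_compact => //; apply: continuous_subspaceT => x.
  rewrite (_ : (fun _ => _) = f \* f); first exact: continuousM (cf x) (cf x).
  by apply/funext => y; rewrite expr2.
exists C; split => // z Cz x Ox; apply: (bC _ Cz); exists x => //.
rewrite closed_ballE ?ltr_pwDr// /closed_ball_/= sub0r normrN.
by apply: bM Ox; rewrite ltr_pwDr// ler_norm.
Qed.

Lemma in_L2_integrableM (f g : V -> R) : in_L2 leb Omega f ->
  in_L2 leb Omega g -> leb.-integrable Omega (fun x => (f x * g x)%:E).
Proof.
have mO := domain_measurable.
move=> [mf if2] [mg ig2].
apply: (le_integrable mO _ _ (integrableD mO if2 ig2)).
  by apply/measurable_EFinP; exact: measurable_funM.
move=> x _; rewrite /= lee_fin [leRHS]ger0_norm ?addr_ge0 ?sqr_ge0//.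
rewrite ler_norml; apply/andP; split; nra.
Qed.

Lemma in_L2D (a : R) (f g : V -> R) : in_L2 leb Omega f ->
  in_L2 leb Omega g -> in_L2 leb Omega (fun x => a * f x + g x).
Proof.
have mO := domain_measurable.
move=> fL gL; have [[mf if2] [mg ig2]] := (fL, gL).
split.
  by apply: measurable_funD => //; apply: measurable_funM => //.
have ifg := in_L2_integrableM fL gL.
have := integrableD mO (integrableD mO (integrableZl mO (a ^+ 2) if2)
  (integrableZl mO (2 * a) ifg)) ig2.
apply: eq_integrable => // x _ /=; rewrite -!EFinM -!EFinD; congr EFin.
by ring.
Qed.

Definition weak_partial (i : 'I_d) (u g : V -> R) :=
  forall phi, test_function Omega phi ->
    \int[leb]_(x in Omega) (u x * pderiv i phi x) =
    - \int[leb]_(x in Omega) (g x * phi x).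

(* A Sobolev function is handled together with its weak gradient, which is
   unique up to a null set: the pair is [(u, grad u)]. This makes [grad] a
   linear operation on [H1] without choosing a representative. *)
Definition H1_pair : {pred (V -> R^o) * (V -> V)} := fun ug =>
  `[< in_L2 leb Omega ug.1 /\ forall i : 'I_d,
      in_L2 leb Omega (fun x => ug.2 x 0 i) /\
      weak_partial i ug.1 (fun x => ug.2 x 0 i) >].

Lemma test_function_in_L2 phi (i : 'I_d) : test_function Omega phi ->
  in_L2 leb Omega phi /\ in_L2 leb Omega (pderiv i phi).
Proof.
move=> [sphi _]; split; apply: continuous_in_L2 => x.
  exact/differentiable_continuous/(sphi [::]).
exact/differentiable_continuous/(sphi [:: i]).
Qed.

Lemma H1_pair_submod : submod_closed H1_pair.
Proof.
have mO := domain_measurable.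
have L20 : in_L2 leb Omega (fun=> 0).
  by apply: continuous_in_L2 => x; exact: cst_continuous.
split=> [|a [u Du] [v Dv] /asboolP[/= uL uH] /asboolP[/= vL vH]].
  apply/asboolP; split => // i; split.
    by under eq_fun do rewrite mxE.
  move=> phi _; under eq_Rintegral do rewrite mul0r.
  under [in RHS]eq_Rintegral do rewrite mxE mul0r.
  by rewrite /Rintegral integral0 oppr0.
apply/asboolP; split; first exact: in_L2D.
move=> i; have [[DuL wu] [DvL wv]] := (uH i, vH i); split.
  by under eq_fun do rewrite !mxE; exact: in_L2D.
move=> phi tphi; have [phiL dphiL] := test_function_in_L2 i tphi.
have key (f g h : V -> R) : in_L2 leb Omega f -> in_L2 leb Omega g ->
    in_L2 leb Omega h ->
    \int[leb]_(x in Omega) ((a * f x + g x) * h x) =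
    a * \int[leb]_(x in Omega) (f x * h x) + \int[leb]_(x in Omega) (g x * h x).
  move=> fL gL hL.
  have fh := in_L2_integrableM fL hL; have gh := in_L2_integrableM gL hL.
  rewrite -RintegralZl// -RintegralD//.
    by apply: eq_Rintegral => x _; ring.
  exact: (integrableZl mO a fh).
rewrite (key u v) // wu// wv//.
under [in RHS]eq_Rintegral do rewrite !mxE.
by rewrite (key (fun x => Du x 0 i) (fun x => Dv x 0 i))//; ring.
Qed.

HB.instance Definition _ :=
  GRing.isSubmodClosed.Build R _ H1_pair H1_pair_submod.

(* H^1(Omega) *)
Record H1 := MkH1 { H1_val : (V -> R^o) * (V -> V) ; _ : H1_val \in H1_pair }.

HB.instance Definition _ := [isSub for H1_val].
HB.instance Definition _ := [Choice of H1 by <:].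
HB.instance Definition _ := [SubChoice_isSubLmodule of H1 by <:].

Definition H1_fun (u : H1) : V -> R := (H1_val u).1.
Definition grad (u : H1) : V -> V := (H1_val u).2.

Coercion H1_fun : H1 >-> Funclass.

(* the closure of C_c^oo(Omega) for the H^1(Omega) norm *)
Definition H10 (u : H1) :=
  forall e : R, 0 < e -> exists2 phi, test_function Omega phi &
    \int[leb]_(x in Omega) ((u x - phi x) ^+ 2 +
      \sum_(i < d) (grad u x 0 i - pderiv i phi x) ^+ 2) < e ^+ 2.

(* membership in L^2_0(Omega); functions in [H1] are square integrable already *)
Definition mean_zero (q : H1) := \int[leb]_(x in Omega) q x = 0.

(* [w : 'I_d -> H1] is a vector field with components in H^1(Omega) *)
Definition H10_field (w : 'I_d -> H1) := forall i, H10 (w i).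

Definition field (w : 'I_d -> H1) : V -> V := fun x => \row_i w i x.

(* entry (i, j) is the j-th partial derivative of the i-th component *)
Definition grad_field (w : 'I_d -> H1) : V -> 'M[R]_d :=
  fun x => \matrix_(i, j) grad (w i) x 0 j.

Definition div_field (w : 'I_d -> H1) : V -> R := fun x => \tr (grad_field w x).

(* (grad w) v, written with row vectors *)
Definition convect (w v : 'I_d -> H1) : V -> V :=
  fun x => field v x *m (grad_field w x)^T.

Definition dotmx {m n} (A B : 'M[R]_(m, n)) := \sum_i \sum_j A i j * B i j.

(* L^2(Omega) products of scalar functions, and of vector or tensor fields *)
Definition dotL2s (f g : V -> R) := \int[leb]_(x in Omega) (f x * g x).

Definition dotL2 {m n} (F G : V -> 'M[R]_(m, n)) :=
  \int[leb]_(x in Omega) dotmx (F x) (G x).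

Definition dotL2_finite {m n} (F G : V -> 'M[R]_(m, n)) :=
  leb.-integrable Omega (fun x => (dotmx (F x) (G x))%:E).

Definition normL2 {m n} (F : V -> 'M[R]_(m, n)) := Num.sqrt (dotL2 F F).

End sobolev.

(* Main.v *)
(** Energy method. Testing the momentum equation with [2 tau u_{n+1}] kills the
    convective terms by skew symmetry, and Young's inequality splits the
    stress-divergence term into [tau |sqrt nu_n grad u_n|^2] and
    [tau |sqrt nu_{n+1} grad u_{n+1}|^2]. The pressure equation turns the
    pressure term into
    [- tau^2 (|grad p_{n+1}|^2 - |grad p_n|^2 + |grad (p_n - p_{n-1})|^2
              - |grad pi|^2)] with [pi = p_{n+1} - 2 p_n + p_{n-1}];
    subtracting two consecutive pressure equations tested with [pi] and
    integrating by parts gives [tau |grad pi| <= |u_{n+1} - u_n|], so that the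
    last term is absorbed by the numerical dissipation of the time
    discretisation. A discrete Gronwall argument concludes, using
    [(1 - 1/N)^{-N} <= exp (N / (N - 1))].

    Skew symmetry on H^1_0 needs [u_i u_j] to be square integrable. This comes
    from Ladyzhenskaya's inequality for test functions in dimension 2 and 3,
    obtained by bounding [phi^2] by a line integral in one coordinate and
    [psi^2] by a line integral in another one, and then by density. *)
Require Import Defs.
From HB Require Import structures.
From mathcomp Require Import all_boot all_order all_algebra.
From mathcomp Require Import all_classical all_reals all_analysis.
From mathcomp Require Import measurable_realfun ring lra.

Set Implicit Arguments.
Unset Strict Implicit.
Unset Printing Implicit Defensive.

Import Order.TTheory GRing.Theory Num.Theory.
Import numFieldNormedType.Exports.

Local Open Scope classical_set_scope.
Local Open Scope ring_scope.

(** * Ladyzhenskaya's inequality for test functions *)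

Section line.
Context {R : realType} {d : nat}.
Local Notation V := 'rV[R]_d.
Local Notation lam := (@lebesgue_measure R).

Lemma le_coord_norm (x : V) (j : 'I_d) : `|x 0 j| <= `|x|.
Proof.
by rewrite [leRHS]mx_normrE; apply/bigmax_geP; right; exists (0, j).
Qed.

Lemma is_derive_line (phi : V -> R) (j : 'I_d) (y : V) (t : R) :
  differentiable phi (t *: delta_mx 0 j + y) ->
  is_derive t 1 (fun s => phi (s *: delta_mx 0 j + y))
    (pderiv j phi (t *: delta_mx 0 j + y)).
Proof.
move=> dphi; have := diff_derivable (v := delta_mx 0 j) dphi.
have E : (fun h : R => h^-1 *: (((fun s => phi (s *: delta_mx 0 j + y)) \o
     shift t) (h *: (1 : R)) - phi (t *: delta_mx 0 j + y))) =
  (fun h : R => h^-1 *: ((phi \o shift (t *: delta_mx 0 j + y))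
     (h *: delta_mx 0 j) - phi (t *: delta_mx 0 j + y))).
  apply/funext => h /=; congr (_ *: (phi _ - _)).
  by rewrite scaler1 scalerDl addrA.
by move=> ?; split; rewrite /derivable /derive /pderiv E.
Qed.

Lemma continuous_line (phi : V -> R) (j : 'I_d) (y : V) :
  continuous phi -> continuous (fun s : R => phi (s *: delta_mx 0 j + y)).
Proof.
move=> cphi s; apply: (@continuous_comp _ _ _ (fun s : R => s *: delta_mx 0 j + y)).
  apply: (@continuousD _ _ _ (fun s : R => s *: delta_mx 0 j) (cst y)).
    exact: scalel_continuous.
  exact: cst_continuous.
exact: cphi.
Qed.

Lemma test_function_smooth Omega (phi : V -> R) :
  test_function Omega phi -> smooth phi.
Proof. by case. Qed.

Lemma smooth_continuous (phi : V -> R) : smooth phi -> continuous phi.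
Proof. by move=> sphi x; exact/differentiable_continuous/(sphi [::]). Qed.

Lemma smooth_pderiv_continuous (phi : V -> R) i :
  smooth phi -> continuous (pderiv i phi).
Proof. by move=> sphi x; exact/differentiable_continuous/(sphi [:: i]). Qed.

(** Compact support makes [phi] vanish far out on the line, so [phi ^+ 2] at [t0] is the integral of
    its derivative from such a far point [a]; enlarging the range to the whole line removes the
    dependence on [t0]. *)
Lemma sqr_le_line_integral Omega (phi : V -> R) (j : 'I_d) (y : V) (t0 : R) :
  test_function Omega phi ->
  ((phi (t0 *: delta_mx 0 j + y) ^+ 2)%:E <=
   \int[lam]_t `|2 * phi (t *: delta_mx 0 j + y) *
                 pderiv j phi (t *: delta_mx 0 j + y)|%:E)%E.
Proof.
move=> tphi; have sphi := test_function_smooth tphi.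
pose g := fun t : R => phi (t *: delta_mx 0 j + y).
pose g' := fun t : R => pderiv j phi (t *: delta_mx 0 j + y).
have dg (t : R) : is_derive t 1 g (g' t) by apply: is_derive_line; exact: (sphi [::]).
have cg : continuous g by apply/continuous_line/smooth_continuous.
have cg' : continuous g' by apply/continuous_line/smooth_pderiv_continuous.
have dg2 (t : R) : is_derive t 1 (fun t => g t ^+ 2) (2 * g t * g' t).
  rewrite (_ : (fun t => g t ^+ 2) = g ^+ 2)//.
  apply: is_derive_eq; rewrite /= expr1 /GRing.scale /=.
  by rewrite mulr_natl.
have cgg' : continuous (fun t => 2 * g t * g' t).
  move=> t; apply: (@continuousM _ _ (fun t => 2 * g t) g'); last exact: cg'.
  by apply: (@continuousM _ _ (fun=> 2) g); [exact: cst_continuous|exact: cg].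
have [K [cK _ K0]] := tphi.2.
have [M [Mr bM]] := compact_bounded cK.
(* The first entry puts [a] to the left of [t0]. The second pushes coordinate [j] of the point below
   [- (M + 2)], hence the point out of the support. *)
pose a : R := Num.min (t0 - 1) (- (M + 2) - y 0 j).
have at0 : a < t0 by rewrite gt_min ltrBlDr ltrDl ltr01.
have ga : g a = 0.
  have M1 : M < M + 1 by rewrite ltrDl.
  apply: K0 => /(bM _ M1) /=; rewrite leNgt => /negP; apply.
  apply: lt_le_trans (le_coord_norm _ j).
  have -> : (a *: delta_mx 0 j + y) 0 j = a + y 0 j.
    by rewrite !mxE !eqxx mulr1.
  rewrite -normrN; apply: lt_le_trans (ler_norm _).
  have : a <= - (M + 2) - y 0 j by rewrite ge_min lexx orbT.
  lra.
have ft : (\int[lam]_(x in `[a, t0]) (2 * g x * g' x)%:E =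
    (g t0 ^+ 2)%:E - (g a ^+ 2)%:E)%E.
  apply: (@continuous_FTC2 _ (fun t => 2 * g t * g' t) (fun t => g t ^+ 2)) => //.
  - exact: continuous_subspaceT.
  - have cg2 : continuous (fun t => g t ^+ 2).
      by move=> x; apply/differentiable_continuous/derivable1_diffP; case: (dg2 x).
    split.
    + by move=> x _; case: (dg2 x).
    + exact/cvg_at_right_filter/cg2.
    + exact/cvg_at_left_filter/cg2.
  - by move=> x _; rewrite derive1E derive_val.
rewrite ga expr0n/= sube0 in ft; rewrite -/(g t0) -ft.
have mf : measurable_fun [set: R] (fun t => 2 * g t * g' t).
  exact: continuous_measurable_fun.
apply: (@le_trans _ _ (\int[lam]_(x in `[a, t0]) `|2 * g x * g' x|%:E)%E).
  apply: le_trans (lee_abs _) _; apply: le_abse_integral => //.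
  exact/measurable_EFinP/measurable_funTS.
apply: ge0_subset_integral => //.
apply/measurable_EFinP/measurableT_comp => //.
Qed.
End line.

(** * Slicing the Lebesgue measure and Tonelli's theorem *)

Section tonelli.
Context {R : realType}.
Local Notation lam := (@lebesgue_measure R).
Local Open Scope ereal_scope.

Lemma continuous_measurable_rV n (f : 'rV[R]_n -> R) :
  continuous f -> measurable_fun [set: 'rV[R]_n] f.
Proof.
move=> cf; apply: (measurability _ (RGenOInfty.measurableE R)).
move=> /= _ [_ [a ->] <-]; rewrite setTI; apply: open_measurable_rV.
by apply: open_comp => //; exact: interval_open.
Qed.

(** The map along which [lebesgue_step] pushes the product measure forward. *)
Definition cons_rV n (z : R * 'rV[R]_n) : 'rV[R]_n.+1 :=
  row_mx (const_mx z.1 : 'rV_1) z.2.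

Lemma cons_rV0 n (z : R * 'rV[R]_n) : cons_rV z 0%R ord0 = z.1.
Proof. by rewrite /cons_rV mxE; case: splitP => [j _|k //]; rewrite mxE. Qed.

Lemma cons_rVS n (z : R * 'rV[R]_n) i : cons_rV z 0%R (lift ord0 i) = z.2 0%R i.
Proof.
rewrite /cons_rV mxE; case: splitP => [[[]]//|k]; rewrite lift0 => -[ik].
by congr (z.2 _ _); exact: val_inj.
Qed.

Lemma measurable_cons_rV n : measurable_fun [set: R * 'rV[R]_n] (@cons_rV n).
Proof.
apply: measurable_fun_rV => i; case: (unliftP ord0 i) => [j|] ->.
  under eq_fun do rewrite cons_rVS.
  exact: (measurableT_comp (measurable_coord j) measurable_snd).
by under eq_fun do rewrite cons_rV0; exact: measurable_fst.
Qed.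

Lemma measurable_cons_rVr n c :
  measurable_fun [set: 'rV[R]_n] (fun v => cons_rV (c, v)).
Proof.
apply: (@measurableT_comp _ _ _ _ _ _ _ _ (fun v => (c, v))
  (@measurable_cons_rV n)).
exact: measurable_fun_pair.
Qed.

(** [lebesgue_rV n.+1] is by definition an image measure under [cons_rV], so a change of variables
    leads to the product measure and Tonelli applies. *)
Lemma integral_cons_rV n (F : 'rV[R]_n.+1 -> \bar R) :
  measurable_fun [set: 'rV[R]_n.+1] F -> (forall x, 0 <= F x) ->
  \int[lebesgue_rV n.+1]_x F x =
  \int[lam]_a \int[lebesgue_rV n]_v F (cons_rV (a, v)).
Proof.
move=> mF F0.
transitivity (\int[lam \x lebesgue_rV n]_z (F \o @cons_rV n) z).
  rewrite -[LHS]/(\int[pushforward (lam \x lebesgue_rV n) (@cons_rV n)]_(x in setT) F x).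
  by rewrite ge0_integral_pushforward//; exact: measurable_cons_rV.
rewrite fubini_tonelli1//.
  by apply: measurableT_comp => //; exact: measurable_cons_rV.
by move=> z; exact: F0.
Qed.

Lemma integral_rV1 (F : 'rV[R]_1 -> \bar R) :
  measurable_fun [set: 'rV[R]_1] F -> (forall x, 0 <= F x) ->
  \int[lebesgue_rV 1]_x F x = \int[lam]_a F (cons_rV (a, 0%R)).
Proof.
move=> mF F0; rewrite integral_cons_rV//; apply: eq_integral => a _.
(* In dimension 0 the measure is the Dirac mass at the only point. *)
rewrite [LHS](@integral_dirac _ _ _ _ setT)//; first by rewrite diracT mul1e.
apply: measurableT_comp => //.
apply: measurableT_comp; first exact: measurable_cons_rV.
exact: measurable_fun_pair.
Qed.

Local Notation e := (delta_mx 0%R).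

(** Sums of multiples of basis vectors are used because, up to reordering the terms, they have the
    shape [t *: delta_mx 0 j + y] of [sqr_le_line_integral]. *)
Definition point2 (z : R * R) : 'rV[R]_2 := (z.1 *: e 0 + z.2 *: e 1)%R.

Definition point3 (c : R) (z : R * R) : 'rV[R]_3 :=
  (c *: e 0 + (z.1 *: e 1 + z.2 *: e 2%:R))%R.

Lemma point2E a b : point2 (a, b) = cons_rV (a, cons_rV (b, 0%R)).
Proof.
apply/rowP => i; case: (unliftP ord0 i) => [j|] ->; rewrite ?cons_rV0 ?cons_rVS.
  rewrite ord1 cons_rV0 !mxE. by rewrite !(mulr0, mulr1, add0r).
rewrite !mxE. by rewrite  !(mulr0, mulr1, addr0).
Qed.

Lemma cons_point2 c z : cons_rV (c, point2 z) = point3 c z.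
Proof.
case: z => a b; rewrite point2E.
apply/rowP => i; case: (unliftP ord0 i) => [j|] ->; rewrite ?cons_rV0 ?cons_rVS.
  case: (unliftP ord0 j) => [k|] ->; rewrite ?cons_rV0 ?cons_rVS.
    by rewrite ord1 cons_rV0 !mxE !(mulr0, mulr1, add0r).
  by rewrite !mxE !(mulr0, mulr1, add0r, addr0).
by rewrite !mxE !(mulr0, mulr1, addr0).
Qed.

Lemma cons_rVE n t (v : 'rV[R]_n) :
  cons_rV (t, v) = (t *: e ord0 + cons_rV (0, v))%R.
Proof.
apply/rowP => i; case: (unliftP ord0 i) => [j|] ->.
  by rewrite [RHS]mxE !cons_rVS [X in _ = (X + _)%R]mxE mxE mulr0 add0r.
by rewrite [RHS]mxE !cons_rV0 [X in _ = (X + _)%R]mxE mxE mulr1 addr0.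
Qed.

Lemma measurable_point2 : measurable_fun [set: R * R] point2.
Proof.
apply: measurable_fun_rV => i; under eq_fun do rewrite !mxE.
by apply: measurable_funD; apply: measurable_funM.
Qed.

Lemma integral_point2 (F : 'rV[R]_2 -> \bar R) :
  measurable_fun [set: 'rV[R]_2] F -> (forall x, 0 <= F x) ->
  \int[lebesgue_rV 2]_x F x = \int[lam \x lam]_z F (point2 z).
Proof.
move=> mF F0; rewrite integral_cons_rV//.
transitivity (\int[lam]_a fubini_F lam (F \o point2) a); last first.
  symmetry; apply: fubini_tonelli1.
    by apply: measurableT_comp => //; exact: measurable_point2.
  by move=> z; exact: F0.
apply: eq_integral => a _; rewrite integral_rV1//.
  by apply: eq_integral => b _; rewrite /= point2E.
apply: measurableT_comp => //.
apply: measurableT_comp; first exact: measurable_cons_rV.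
exact: measurable_fun_pair.
Qed.

(* The Tonelli step of Ladyzhenskaya's inequality. *)
Lemma integral_mul_le (P Q h k : R * R -> \bar R) :
  measurable_fun setT P -> measurable_fun setT Q ->
  measurable_fun setT h -> measurable_fun setT k ->
  (forall z, 0 <= P z) -> (forall z, 0 <= Q z) ->
  (forall z, 0 <= h z) -> (forall z, 0 <= k z) ->
  (forall z, P z <= \int[lam]_t h (t, z.2)) ->
  (forall z, Q z <= \int[lam]_t k (z.1, t)) ->
  \int[lam \x lam]_z (P z * Q z) <=
  (\int[lam \x lam]_z h z) * (\int[lam \x lam]_z k z).
Proof.
move=> mP mQ mh mk P0 Q0 h0 k0 Ph Qk.
(* [P z] is bounded by [A z.2] and [Q z] by [B z.1]: the product of the bounds has separated
   variables, so its integral factors. *)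
pose A := fubini_G lam h; pose B := fubini_F lam k.
have mA : measurable_fun setT A by exact: measurable_fun_fubini_tonelli_G.
have mB : measurable_fun setT B by exact: measurable_fun_fubini_tonelli_F.
have A0 t : 0 <= A t by exact: integral_ge0.
have B0 t : 0 <= B t by exact: integral_ge0.
have mAB : measurable_fun [set: R * R] (fun z => B z.1 * A z.2).
  apply: emeasurable_funM; first exact: (measurableT_comp mB).
  exact: (measurableT_comp mA).
have AB0 (z : R * R) : 0 <= B z.1 * A z.2 by exact: mule_ge0.
apply: (@le_trans _ _ (\int[lam \x lam]_z (B z.1 * A z.2))).
  apply: ge0_le_integral => //.
  - by move=> z _; exact: mule_ge0.
  - exact: emeasurable_funM.
  - by move=> z _; rewrite muleC; exact: lee_pmul.
have -> : \int[lam \x lam]_z h z = \int[lam]_b A b by exact: fubini_tonelli2.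
have -> : \int[lam \x lam]_z k z = \int[lam]_a B a by exact: fubini_tonelli1.
have -> : \int[lam \x lam]_z (B z.1 * A z.2) =
    \int[lam]_a fubini_F lam (fun z => B z.1 * A z.2) a.
  exact: fubini_tonelli1.
rewrite muleC -ge0_integralZr//; last exact: integral_ge0.
rewrite le_eqVlt; apply/predU1P; left.
by apply: eq_integral => a _; rewrite /fubini_F/= ge0_integralZl.
Qed.

End tonelli.

(** * The integrand of the squared H^1 norm *)

Section h1sq.
Context {R : realType} {d : nat}.
Local Notation V := 'rV[R]_d.

(** [g] is kept apart from [f] so that it may be a classical gradient, a weak one, or a difference
    of the two. *)
Definition h1sq (f : V -> R) (g : 'I_d -> V -> R) (x : V) : R :=
  f x ^+ 2 + \sum_i g i x ^+ 2.

Lemma h1sq_ge0 f g x : 0 <= h1sq f g x.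
Proof. by rewrite addr_ge0 ?sqr_ge0// sumr_ge0// => i _; rewrite sqr_ge0. Qed.

Lemma le_h1sq f g i x : f x ^+ 2 + g i x ^+ 2 <= h1sq f g x.
Proof.
rewrite lerD2l (bigD1 i)//= lerDl sumr_ge0// => j _; exact: sqr_ge0.
Qed.

Lemma le_h1sq_mul f g i x : `|2 * f x * g i x| <= h1sq f g x.
Proof.
apply: le_trans (le_h1sq f g i x); rewrite ler_norml.
have := sqr_ge0 (f x + g i x); have := sqr_ge0 (f x - g i x).
by rewrite sqrrB sqrrD => *; apply/andP; split; lra.
Qed.

Lemma le_h1sq_grad f g i x : g i x ^+ 2 <= h1sq f g x.
Proof. by apply: le_trans (le_h1sq f g i x); rewrite lerDr sqr_ge0. Qed.

Lemma measurable_h1sq D f g : measurable_fun D f ->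
  (forall i, measurable_fun D (g i)) -> measurable_fun D (h1sq f g).
Proof.
move=> mf mg; apply: measurable_funD; first exact: measurable_funX.
by apply: measurable_sum => i; exact: measurable_funX.
Qed.

End h1sq.

(** * Young's inequality with a free weight *)

Section young.
Context {R : realType}.

(** A converse of Young's inequality: optimising over the weight [l] recovers the multiplicative
    bound. *)
Lemma sqr_le_of_young (X D s : R) : 0 <= X -> 0 <= D -> 0 < s ->
  (forall l, 0 < l -> X <= l * s + l^-1 * D) -> X ^+ 2 <= 4 * s * D.
Proof.
move=> X0 D0 s0 H; move: X0; rewrite le_eqVlt => /predU1P[<-|X0].
  by rewrite expr0n/= !mulr_ge0// ltW.
(* This weight makes [l * s] equal to half of [X], which the left-hand side absorbs. *)
have := H (X / (2 * s)); rewrite divr_gt0 ?mulr_gt0// => /(_ isT).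
have -> : X / (2 * s) * s = X / 2 by field; rewrite gt_eqF.
rewrite invf_div => XX.
have : X <= 2 * (2 * s / X * D) by lra.
rewrite -(ler_pM2l X0) -expr2 => /le_trans; apply.
by rewrite le_eqVlt; apply/predU1P; left; field; rewrite gt_eqF.
Qed.

Local Open Scope ereal_scope.

(** Optimising both weights gives [X ^+ 2 <= 4 * s * D] and [Y ^+ 2 <= 4 * t * E]; the
    arithmetic-geometric mean inequality then bounds the product. The hypotheses in additive form
    avoid square roots of extended reals. *)
Lemma mule_le_of_young (X Y D E : \bar R) (s t : R) :
  0 <= X -> 0 <= Y -> 0 <= D -> 0 <= E -> (0 < s)%R -> (0 < t)%R ->
  (forall l : R, (0 < l)%R -> X <= (l * s)%:E + l^-1%:E * D) ->
  (forall l : R, (0 < l)%R -> Y <= (l * t)%:E + l^-1%:E * E) ->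
  X * Y <= 2%:E * t%:E * D + 2%:E * s%:E * E.
Proof.
move=> X0 Y0 D0 E0 s0 t0 HX HY; rewrite -!EFinM.
have s2 : (0 < 2 * s)%R by rewrite mulr_gt0.
have t2 : (0 < 2 * t)%R by rewrite mulr_gt0.
(* If [D] or [E] is infinite, so is the right-hand side, since [s] and [t] are positive; otherwise
   everything is real. *)
have [->|Doo] := eqVneq D +oo.
  by rewrite gt0_muley ?lte_fin// addye ?leey// -ltNye (lt_le_trans (ltNyr 0%R))// mule_ge0// lee_fin ltW.
have [->|Eoo] := eqVneq E +oo.
  by rewrite gt0_muley ?lte_fin// addey ?leey// -ltNye (lt_le_trans (ltNyr 0%R))// mule_ge0// lee_fin ltW.
have Df : D \is a fin_num by rewrite ge0_fin_numE// ltey.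
have Ef : E \is a fin_num by rewrite ge0_fin_numE// ltey.
clear Doo Eoo.
rewrite -(fineK Df) -(fineK Ef) in D0 E0 HX HY *.
move: (fine D) (fine E) D0 E0 HX HY {Df Ef} => {}D {}E D0 E0 HX HY.
have Xf : X \is a fin_num.
  by rewrite ge0_fin_numE//; apply: le_lt_trans (HX _ ltr01) (ltry _).
have Yf : Y \is a fin_num.
  by rewrite ge0_fin_numE//; apply: le_lt_trans (HY _ ltr01) (ltry _).
rewrite -(fineK Xf) -(fineK Yf) in X0 Y0 HX HY *.
move: (fine X) (fine Y) X0 Y0 HX HY {Xf Yf} => {}X {}Y X0 Y0 HX HY.
rewrite !lee_fin in X0 Y0 D0 E0.
have XX : (X ^+ 2 <= 4 * s * D)%R.
  by apply: sqr_le_of_young => // l l0; have := HX l l0; rewrite -EFinM -EFinD lee_fin.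
have YY : (Y ^+ 2 <= 4 * t * E)%R.
  by apply: sqr_le_of_young => // l l0; have := HY l l0; rewrite -EFinM -EFinD lee_fin.
rewrite -!EFinM -EFinD lee_fin -ler_sqr ?nnegrE ?mulr_ge0 ?addr_ge0 ?mulr_ge0 ?(ltW s0) ?(ltW t0)//.
rewrite exprMn; apply: (@le_trans _ _ ((4 * s * D) * (4 * t * E)))%R.
  by apply: ler_pM => //; rewrite sqr_ge0.
(* The square of the sum of two numbers minus four times their product is the square of their
   difference. *)
rewrite -subr_ge0; set z := (X in (0 <= X)%R).
have -> : z = ((2 * t * D - 2 * s * E) ^+ 2)%R by rewrite /z; ring.
exact: sqr_ge0.
Qed.

Lemma integral_young {disp} {T : measurableType disp}
    (mu : {measure set T -> \bar R}) (f g : T -> R) (l : R) :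
  measurable_fun setT f -> measurable_fun setT g -> (0 < l)%R ->
  \int[mu]_z `|2 * f z * g z|%:E <=
  l%:E * \int[mu]_z (f z ^+ 2)%:E + l^-1%:E * \int[mu]_z (g z ^+ 2)%:E.
Proof.
move=> mf mg l0; have l0' := ltW l0.
have li0 : (0 <= l^-1)%R by rewrite invr_ge0.
have mf2 : measurable_fun setT (fun z => (f z ^+ 2)%:E).
  by apply/measurable_EFinP; exact: measurable_funX.
have mg2 : measurable_fun setT (fun z => (g z ^+ 2)%:E).
  by apply/measurable_EFinP; exact: measurable_funX.
rewrite -!ge0_integralZl ?lee_fin//; try by move=> x _; rewrite lee_fin sqr_ge0.
rewrite -ge0_integralD//; first last.
- exact: measurable_funeM.
- by move=> x _; rewrite -EFinM lee_fin mulr_ge0// sqr_ge0.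
- exact: measurable_funeM.
- by move=> x _; rewrite -EFinM lee_fin mulr_ge0// sqr_ge0.
apply: ge0_le_integral => //.
- apply/measurable_EFinP/measurableT_comp => //.
  by apply: measurable_funM => //; apply: measurable_funM.
- by apply: emeasurable_funD; exact: measurable_funeM.
- move=> x _; rewrite -!EFinM -EFinD lee_fin.
  rewrite -(ler_pM2l l0) mulrDr mulVKf ?gt_eqF// -[X in (X * _ <= _)%R]gtr0_norm//.
  rewrite -normrM ler_norml; apply/andP; split; rewrite -subr_ge0;
   set z := (X in (0 <= X)%R).
    have -> : z = ((l * f x + g x) ^+ 2)%R by rewrite /z; ring.
    exact: sqr_ge0.
  have -> : z = ((l * f x - g x) ^+ 2)%R by rewrite /z; ring.
  exact: sqr_ge0.
Qed.

Lemma ge0_integral_lin {disp} {T : measurableType disp}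
    (mu : {measure set T -> \bar R}) (a b : \bar R) (f g : T -> \bar R) :
  measurable_fun setT f -> measurable_fun setT g ->
  (forall x, 0 <= f x) -> (forall x, 0 <= g x) -> 0 <= a -> 0 <= b ->
  measurable_fun setT (fun x => a * f x + b * g x) /\
  \int[mu]_x (a * f x + b * g x) = a * \int[mu]_x f x + b * \int[mu]_x g x.
Proof.
move=> mf mg f0 g0 a0 b0.
have maf := measurable_funeM a mf; have mbg := measurable_funeM b mg.
split; first exact: emeasurable_funD.
rewrite ge0_integralD//; last 2 first.
- by move=> x _; exact: mule_ge0.
- by move=> x _; exact: mule_ge0.
by rewrite !ge0_integralZl.
Qed.

End young.

(** * Ladyzhenskaya's inequality in dimensions 2 and 3 *)

Section ladyzhenskaya.
Context {R : realType}.
Local Notation lam := (@lebesgue_measure R).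
Local Open Scope ereal_scope.

Section common.
Variables (d : nat) (Omega : set 'rV[R]_d) (phi : 'rV[R]_d -> R).
Hypothesis tphi : test_function Omega phi.

Lemma measurable_test : measurable_fun setT phi.
Proof.
exact: continuous_measurable_rV (smooth_continuous (test_function_smooth tphi)).
Qed.

Lemma measurable_pderiv_test i : measurable_fun setT (pderiv i phi).
Proof.
apply: continuous_measurable_rV.
exact: smooth_pderiv_continuous (test_function_smooth tphi).
Qed.

Lemma measurable_test_h1sq :
  measurable_fun setT (fun x => (h1sq phi (pderiv^~ phi) x)%:E).
Proof.
apply/measurable_EFinP; apply: measurable_h1sq; first exact: measurable_test.
exact: measurable_pderiv_test.
Qed.

Lemma measurable_test_mul i :
  measurable_fun setT (fun x => `|2 * phi x * pderiv i phi x|%:E).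
Proof.
apply/measurable_EFinP/measurableT_comp => //.
apply: measurable_funM; last exact: measurable_pderiv_test.
by apply: measurable_funM => //; exact: measurable_test.
Qed.

Lemma integral_test_mul_le i :
  \int[lebesgue_rV d]_x `|2 * phi x * pderiv i phi x|%:E <=
  \int[lebesgue_rV d]_x (h1sq phi (pderiv^~ phi) x)%:E.
Proof.
apply: ge0_le_integral => //; first exact: measurable_test_mul.
  exact: measurable_test_h1sq.
by move=> x _; rewrite lee_fin (le_h1sq_mul phi (pderiv^~ phi)).
Qed.

Lemma integral_test_grad_le i :
  \int[lebesgue_rV d]_x (pderiv i phi x ^+ 2)%:E <=
  \int[lebesgue_rV d]_x (h1sq phi (pderiv^~ phi) x)%:E.
Proof.
apply: ge0_le_integral => //.
- by move=> x _; rewrite lee_fin sqr_ge0.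
- by apply/measurable_EFinP; apply: measurable_funX; exact: measurable_pderiv_test.
- exact: measurable_test_h1sq.
by move=> x _; rewrite lee_fin (le_h1sq_grad phi (pderiv^~ phi)).
Qed.

End common.

(** [phi ^+ 2] is bounded by a line integral in direction 0, a function of the second coordinate
    only, and [psi ^+ 2] by one in direction 1, a function of the first only. *)
Lemma ladyzhenskaya2 (Omega : set 'rV[R]_2) (phi psi : 'rV[R]_2 -> R) :
  test_function Omega phi -> test_function Omega psi ->
  \int[lebesgue_rV 2]_x (phi x ^+ 2 * psi x ^+ 2)%:E <=
  (\int[lebesgue_rV 2]_x (h1sq phi (pderiv^~ phi) x)%:E) *
  \int[lebesgue_rV 2]_x (h1sq psi (pderiv^~ psi) x)%:E.
Proof.
move=> tphi tpsi.
have mphi := measurable_test tphi; have mpsi := measurable_test tpsi.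
rewrite integral_point2; first last.
- by move=> x; rewrite lee_fin mulr_ge0 ?sqr_ge0.
- by apply/measurable_EFinP; apply: measurable_funM; exact: measurable_funX.
pose h x : \bar R := `|2 * phi x * pderiv 0 phi x|%:E.
pose k x : \bar R := `|2 * psi x * pderiv 1 psi x|%:E.
apply: (@le_trans _ _ ((\int[lam \x lam]_z h (point2 z)) *
    \int[lam \x lam]_z k (point2 z))).
  under eq_integral do rewrite EFinM.
  have m2 := @measurable_point2 R.
  apply: (integral_mul_le (P := fun z => (phi (point2 z) ^+ 2)%:E)
    (Q := fun z => (psi (point2 z) ^+ 2)%:E)).
  - by apply/measurable_EFinP; apply: measurable_funX; exact: (measurableT_comp mphi m2).
  - by apply/measurable_EFinP; apply: measurable_funX; exact: (measurableT_comp mpsi m2).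
  - exact: (measurableT_comp (measurable_test_mul tphi _) m2).
  - exact: (measurableT_comp (measurable_test_mul tpsi _) m2).
  - by move=> z; rewrite lee_fin sqr_ge0.
  - by move=> z; rewrite lee_fin sqr_ge0.
  - by move=> z; rewrite lee_fin.
  - by move=> z; rewrite lee_fin.
  - move=> z; exact: sqr_le_line_integral tphi.
  - move=> z; rewrite /k /point2 /= addrC; under eq_integral do rewrite addrC.
    exact: sqr_le_line_integral tpsi.
have h0 x : 0 <= h x by rewrite lee_fin.
have k0 x : 0 <= k x by rewrite lee_fin.
rewrite -(integral_point2 (measurable_test_mul tphi 0%R) h0).
rewrite -(integral_point2 (measurable_test_mul tpsi 1%R) k0).
apply: lee_pmul; rewrite ?integral_ge0//.
  exact: integral_test_mul_le tphi _.
exact: integral_test_mul_le tpsi _.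
Qed.

Section three.
Variables (Omega : set 'rV[R]_3) (phi : 'rV[R]_3 -> R).
Hypothesis tphi : test_function Omega phi.

(** The line integral in direction 0 bounds [phi ^+ 2] on the slice by a quantity free of [c];
    integrating it over [v] and exchanging the integrals gives a full space integral, so the bound
    is uniform in [c]. *)
Lemma slice_sqr_le c :
  \int[lebesgue_rV 2]_v (phi (cons_rV (c, v)) ^+ 2)%:E <=
  \int[lebesgue_rV 3]_x (h1sq phi (pderiv^~ phi) x)%:E.
Proof.
pose h x : \bar R := `|2 * phi x * pderiv 0 phi x|%:E.
have mh : measurable_fun setT (h \o @cons_rV R 2).
  apply: measurableT_comp (measurable_test_mul tphi _) _.
  exact: measurable_cons_rV.
have h0 x : 0 <= h x by rewrite lee_fin.
have h0' z : 0 <= (h \o @cons_rV R 2) z by exact: h0.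
apply: (@le_trans _ _ (\int[lebesgue_rV 3]_x h x)); last first.
  exact: integral_test_mul_le tphi _.
rewrite (integral_cons_rV (measurable_test_mul tphi 0%R) h0).
have -> : \int[lam]_t \int[lebesgue_rV 2]_v h (cons_rV (t, v)) =
    \int[lebesgue_rV 2]_v \int[lam]_t h (cons_rV (t, v)).
  transitivity (\int[lam \x lebesgue_rV 2]_w (h \o @cons_rV R 2) w).
    by symmetry; exact: fubini_tonelli1.
  exact: fubini_tonelli2.
apply: ge0_le_integral => //.
- by move=> x _; rewrite lee_fin sqr_ge0.
- apply/measurable_EFinP; apply: measurable_funX.
  exact: (measurableT_comp (measurable_test tphi) (@measurable_cons_rVr R 2 c)).
- exact: (@measurable_fun_fubini_tonelli_G _ _ _ _ _ lam _ mh h0').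
- move=> v _; rewrite cons_rVE; under eq_integral do rewrite cons_rVE.
  exact: sqr_le_line_integral tphi.
Qed.

(** Young's inequality on the slice, with the zero order term replaced by its uniform bound [s]. The
    weight [l] stays free, to be optimised in [mule_le_of_young]. *)
Lemma slice_mul_le i (s l : R) c : (0 < l)%R ->
  \int[lebesgue_rV 3]_x (h1sq phi (pderiv^~ phi) x)%:E <= s%:E ->
  \int[lebesgue_rV 2]_v
     `|2 * phi (cons_rV (c, v)) * pderiv i phi (cons_rV (c, v))|%:E <=
  (l * s)%:E + l^-1%:E *
     \int[lebesgue_rV 2]_v (pderiv i phi (cons_rV (c, v)) ^+ 2)%:E.
Proof.
move=> l0 Hs.
apply: le_trans (integral_young (lebesgue_rV 2) _ _ l0) _.
- exact: (measurableT_comp (measurable_test tphi) (@measurable_cons_rVr R 2 c)).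
- exact: (measurableT_comp (measurable_pderiv_test tphi i) (@measurable_cons_rVr R 2 c)).
rewrite leeD2r// EFinM; apply: lee_wpmul2l; first by rewrite lee_fin ltW.
exact: le_trans (slice_sqr_le c) Hs.
Qed.

End three.

Lemma measurable_slice n (F : 'rV[R]_n.+1 -> \bar R) :
  measurable_fun setT F -> (forall x, 0 <= F x) ->
  measurable_fun setT (fun c => \int[lebesgue_rV n]_v F (cons_rV (c, v))).
Proof.
move=> mF F0; apply: (measurable_fun_fubini_tonelli_F (F \o @cons_rV R n)).
  exact: (measurableT_comp mF (@measurable_cons_rV R n)).
by move=> x; exact: F0.
Qed.

(* The two-dimensional estimate holds on each slice [x_0 = c]. Cauchy-Schwarz
   on the slice leaves [\int phi(c, v)^2 dv], which is bounded uniformly in [c]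
   by a line integral in the direction [x_0]. *)
Lemma ladyzhenskaya3 (Omega : set 'rV[R]_3) (phi psi : 'rV[R]_3 -> R) (s t : R) :
  test_function Omega phi -> test_function Omega psi ->
  (0 < s)%R -> (0 < t)%R ->
  \int[lebesgue_rV 3]_x (h1sq phi (pderiv^~ phi) x)%:E <= s%:E ->
  \int[lebesgue_rV 3]_x (h1sq psi (pderiv^~ psi) x)%:E <= t%:E ->
  \int[lebesgue_rV 3]_x (phi x ^+ 2 * psi x ^+ 2)%:E <= (4 * s * t)%:E.
Proof.
move=> tphi tpsi s0 t0 Hs Ht.
have mphi := measurable_test tphi; have mpsi := measurable_test tpsi.
have mint : measurable_fun setT (fun x => (phi x ^+ 2 * psi x ^+ 2)%:E).
  by apply/measurable_EFinP; apply: measurable_funM; exact: measurable_funX.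
have int0 x : 0 <= (phi x ^+ 2 * psi x ^+ 2)%:E.
  by rewrite lee_fin mulr_ge0 ?sqr_ge0.
rewrite integral_cons_rV//.
pose h x : \bar R := `|2 * phi x * pderiv 1 phi x|%:E.
pose k x : \bar R := `|2 * psi x * pderiv 2%:R psi x|%:E.
pose dphi x := (pderiv 1 phi x ^+ 2)%:E.
pose dpsi x := (pderiv 2%:R psi x ^+ 2)%:E.
have mdphi : measurable_fun setT dphi.
  by apply/measurable_EFinP; apply: measurable_funX; exact: measurable_pderiv_test tphi _.
have mdpsi : measurable_fun setT dpsi.
  by apply/measurable_EFinP; apply: measurable_funX; exact: measurable_pderiv_test tpsi _.
have dphi0 x : 0 <= dphi x by rewrite lee_fin sqr_ge0.
have dpsi0 x : 0 <= dpsi x by rewrite lee_fin sqr_ge0.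
pose D c := \int[lebesgue_rV 2]_v dphi (cons_rV (c, v)).
pose E c := \int[lebesgue_rV 2]_v dpsi (cons_rV (c, v)).
have D0 c : 0 <= D c by apply: integral_ge0.
have E0 c : 0 <= E c by apply: integral_ge0.
have t2 : 0 <= 2%:E * t%:E by rewrite -EFinM lee_fin mulr_ge0// ltW.
have s2 : 0 <= 2%:E * s%:E by rewrite -EFinM lee_fin mulr_ge0// ltW.
have [mDE intDE] := ge0_integral_lin lam (measurable_slice mdphi dphi0)
  (measurable_slice mdpsi dpsi0) D0 E0 t2 s2.
apply: (@le_trans _ _
    (\int[lam]_c (2%:E * t%:E * D c + 2%:E * s%:E * E c))).
  apply: ge0_le_integral => //.
  - by move=> c _; exact: integral_ge0.
  - exact: (measurable_slice (F := fun x => (phi x ^+ 2 * psi x ^+ 2)%:E)).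
  move=> c _.
  have h0 x : 0 <= h x by rewrite lee_fin.
  have k0 x : 0 <= k x by rewrite lee_fin.
  have mc := @measurable_cons_rVr R 2 c.
  apply: (@le_trans _ _ ((\int[lebesgue_rV 2]_v h (cons_rV (c, v))) *
      \int[lebesgue_rV 2]_v k (cons_rV (c, v)))); last first.
    have hk0 g : (forall x, 0 <= g x) ->
      0 <= \int[lebesgue_rV 2]_v g (cons_rV (c, v)) by move=> g0; exact: integral_ge0.
    apply: (mule_le_of_young (hk0 _ h0) (hk0 _ k0) (D0 c) (E0 c) s0 t0).
      by move=> l l0; exact: slice_mul_le tphi _ _ _ _ l0 Hs.
    by move=> l l0; exact: slice_mul_le tpsi _ _ _ _ l0 Ht.
  have mh : measurable_fun setT (fun v => h (cons_rV (c, v))).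
    exact: (measurableT_comp (measurable_test_mul tphi _) mc).
  have mk : measurable_fun setT (fun v => k (cons_rV (c, v))).
    exact: (measurableT_comp (measurable_test_mul tpsi _) mc).
  rewrite (integral_point2 mh)// (integral_point2 mk)//.
  rewrite (integral_point2 (F := fun v => (phi (cons_rV (c, v)) ^+ 2 *
    psi (cons_rV (c, v)) ^+ 2)%:E))//; last exact: (measurableT_comp mint mc).
  under eq_integral do rewrite EFinM.
  have m3 : measurable_fun setT (fun z => cons_rV (c, point2 z)).
    exact: (measurableT_comp mc (@measurable_point2 R)).
  apply: (integral_mul_le (P := fun z => (phi (cons_rV (c, point2 z)) ^+ 2)%:E)
    (Q := fun z => (psi (cons_rV (c, point2 z)) ^+ 2)%:E)).
  - by apply/measurable_EFinP; apply: measurable_funX; exact: (measurableT_comp mphi m3).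
  - by apply/measurable_EFinP; apply: measurable_funX; exact: (measurableT_comp mpsi m3).
  - exact: (measurableT_comp (measurable_test_mul tphi _) m3).
  - exact: (measurableT_comp (measurable_test_mul tpsi _) m3).
  - by move=> z; rewrite lee_fin sqr_ge0.
  - by move=> z; rewrite lee_fin sqr_ge0.
  - by move=> z; rewrite lee_fin.
  - by move=> z; rewrite lee_fin.
  (* Reordering the sum brings the integrated direction to the front; direction 1 is used for [phi],
     direction 2 for [psi]. *)
  - move=> z; rewrite cons_point2 /h /point3 /= addrCA.
    under eq_integral do rewrite cons_point2 /point3 addrCA.
    exact: sqr_le_line_integral tphi.
  - move=> z; rewrite cons_point2 /k /point3 /= addrA addrC.
    under eq_integral do rewrite cons_point2 /point3 addrA addrC.
    exact: sqr_le_line_integral tpsi.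
rewrite intDE.
have Ds := le_trans (integral_test_grad_le tphi 1%R) Hs.
have Et := le_trans (integral_test_grad_le tpsi 2%:R%R) Ht.
rewrite (integral_cons_rV mdphi dphi0) in Ds.
rewrite (integral_cons_rV mdpsi dpsi0) in Et.
(* Integrating [D] and [E] over all slices gives at most [s] and [t], whence the constant 4. *)
apply: (@le_trans _ _ (2%:E * t%:E * s%:E + 2%:E * s%:E * t%:E)).
  apply: leeD; apply: lee_wpmul2l; [exact: t2|exact: Ds|exact: s2|exact: Et].
by rewrite -!EFinM -EFinD lee_fin le_eqVlt; apply/predU1P; left; ring.
Qed.

Lemma ladyzhenskaya d (Omega : set 'rV[R]_d) (phi psi : 'rV[R]_d -> R) (s t : R) :
  d = 2%N \/ d = 3%N ->
  test_function Omega phi -> test_function Omega psi ->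
  (0 < s)%R -> (0 < t)%R ->
  \int[lebesgue_rV d]_x (h1sq phi (pderiv^~ phi) x)%:E <= s%:E ->
  \int[lebesgue_rV d]_x (h1sq psi (pderiv^~ psi) x)%:E <= t%:E ->
  \int[lebesgue_rV d]_x (phi x ^+ 2 * psi x ^+ 2)%:E <= (4 * s * t)%:E.
Proof.
move=> [] d23; subst d => tphi tpsi s0 t0 Hs Ht.
  apply: le_trans (ladyzhenskaya2 tphi tpsi) _.
  (* In dimension 2 the constant is 1; it is weakened to 4 to share one statement with dimension
     3. *)
  apply: (@le_trans _ _ (s%:E * t%:E)).
    apply: lee_pmul => //; apply: integral_ge0 => x _; rewrite lee_fin;
    exact: h1sq_ge0.
  rewrite -EFinM lee_fin -subr_ge0.
  have -> : (4 * s * t - s * t = 3 * (s * t))%R by ring.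
  by rewrite !mulr_ge0// ltW.
exact: ladyzhenskaya3 tphi tpsi s0 t0 Hs Ht.
Qed.

End ladyzhenskaya.

(** * Products in H^1_0 and skew symmetry of convection *)

Section smooth.
Context {R : realType} {d : nat}.
Local Notation V := 'rV[R]_d.
Implicit Types (f g phi psi : V -> R).

(** Smoothness graded by order, peeling off the innermost derivative; this allows an induction in
    which both factors of a product lose regularity. *)
Fixpoint smooth_upto n f : Prop :=
  (forall x, differentiable f x) /\
  (if n is m.+1 then forall i, smooth_upto m (pderiv i f) else True).

Lemma smooth_uptoP f : smooth f <-> forall n, smooth_upto n f.
Proof.
split=> [sf n|sf s].
  elim: n f sf => [|n IHn] f sf /=; first by split=> // x; exact: (sf [::]).
  split=> [x|i]; first exact: (sf [::]).
  by apply: IHn => s x; have := sf (rcons s i) x; rewrite foldr_rcons.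
elim/last_ind: s f sf => [|s i IHs] f sf x; first by case: (sf 0%N) => + _; exact.
by rewrite foldr_rcons; apply: IHs => n; case: (sf n.+1) => _; exact.
Qed.

Lemma smooth_uptoW n f : smooth_upto n.+1 f -> smooth_upto n f.
Proof.
elim: n f => [|n IHn] f /= [df sf]; first by split.
by split=> // i; exact: IHn.
Qed.

Lemma pderiv_lin i a f g x : differentiable f x -> differentiable g x ->
  pderiv i (fun x => a * f x + g x) x = a * pderiv i f x + pderiv i g x.
Proof.
move=> df dg; rewrite /pderiv.
have df' := diff_derivable (v := delta_mx 0 i) df.
have dg' := diff_derivable (v := delta_mx 0 i) dg.
rewrite (_ : (fun x => a * f x + g x) = a \*: f + g)//.
rewrite deriveD//; last exact: derivableZ.
by rewrite deriveZ.
Qed.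

Lemma pderiv_mul i f g x : differentiable f x -> differentiable g x ->
  pderiv i (fun x => f x * g x) x = f x * pderiv i g x + g x * pderiv i f x.
Proof.
move=> df dg; rewrite /pderiv.
have df' := diff_derivable (v := delta_mx 0 i) df.
have dg' := diff_derivable (v := delta_mx 0 i) dg.
by rewrite (_ : (fun x => f x * g x) = f * g)// deriveM.
Qed.

Lemma differentiable_lin a f g x : differentiable f x -> differentiable g x ->
  differentiable (fun x => a * f x + g x) x.
Proof.
by move=> df dg; exact: (differentiableD (differentiableZ a df) dg).
Qed.

Lemma smooth_upto_lin n a f g : smooth_upto n f -> smooth_upto n g ->
  smooth_upto n (fun x => a * f x + g x).
Proof.
elim: n f g => [|n IHn] f g /= [df sf] [dg sg].
  by split=> // x; exact: differentiable_lin.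
split=> [x|i]; first exact: differentiable_lin.
rewrite (_ : pderiv i _ = fun x => a * pderiv i f x + pderiv i g x).
  exact: IHn.
by apply/funext => x; exact: pderiv_lin.
Qed.

Lemma smooth_upto_mul n f g : smooth_upto n f -> smooth_upto n g ->
  smooth_upto n (fun x => f x * g x).
Proof.
elim: n f g => [|n IHn] f g sf sg; have [df sf'] := sf; have [dg sg'] := sg.
  by split=> // x; apply: (@differentiableM _ _ f g).
split=> [x|i]; first exact: (@differentiableM _ _ f g).
(* Leibniz' rule, with a factor 1 to fit the shape of [smooth_upto_lin]; each product involves only
   derivatives of order [n]. *)
rewrite (_ : pderiv i _ =
    fun x => 1 * (f x * pderiv i g x) + g x * pderiv i f x).
  have sfn := smooth_uptoW sf; have sgn := smooth_uptoW sg.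
  exact: (smooth_upto_lin _ (IHn _ _ sfn (sg' i)) (IHn _ _ sgn (sf' i))).
by apply/funext => x; rewrite mul1r; exact: pderiv_mul.
Qed.

Lemma test_function_lin Omega a f g :
  test_function Omega f -> test_function Omega g ->
  test_function Omega (fun x => a * f x + g x).
Proof.
move=> [/smooth_uptoP sf [K [cK KO K0]]] [/smooth_uptoP sg [L [cL LO L0]]].
split; first by apply/smooth_uptoP => n; exact: smooth_upto_lin.
exists (K `|` L); split; first exact: compactU.
  by move=> x [/KO|/LO].
by move=> x /not_orP[/K0 -> /L0 ->]; rewrite mulr0 addr0.
Qed.

Lemma test_function_mul Omega f g :
  test_function Omega f -> test_function Omega g ->
  test_function Omega (fun x => f x * g x).
Proof.
move=> [/smooth_uptoP sf [K [cK KO K0]]] [/smooth_uptoP sg _].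
split; first by apply/smooth_uptoP => n; exact: smooth_upto_mul.
by exists K; split => // x /K0 ->; rewrite mul0r.
Qed.

Lemma test_differentiable Omega f x : test_function Omega f -> differentiable f x.
Proof. by move=> [/(_ [::])]. Qed.

(** The complement of the compact support set is open, so [f] vanishes near [x]. *)
Lemma test_pderiv_out Omega f i x :
  test_function Omega f -> ~ Omega x -> pderiv i f x = 0.
Proof.
move=> [_ [K [cK KO K0]]] Ox.
have oK : open (~` K).
  by apply: closed_openC; apply: compact_closed => //; exact: norm_hausdorff.
rewrite -(derive_cst (0 : R) x (delta_mx 0 i)); apply: near_eq_derive.
have : nbhs x (~` K) by apply: open_nbhs_nbhs; split => // /KO.
by apply: filterS => y /K0.
Qed.

Lemma test_out Omega f x : test_function Omega f -> ~ Omega x -> f x = 0.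
Proof. by move=> [_ [K [_ KO K0]]] Ox; apply: K0 => /KO. Qed.

Lemma test_bounded Omega f : test_function Omega f ->
  exists2 M, 0 <= M & forall x, `|f x| <= M.
Proof.
move=> [sf [K [cK _ K0]]].
have /compact_bounded[M [Mr bM]] : compact (f @` K).
  apply: continuous_compact => //; apply: continuous_subspaceT.
  exact: smooth_continuous.
exists (`|M| + 1) => [|x]; first by rewrite addr_ge0.
have [Kx|/K0 ->] := pselect (K x); last by rewrite normr0 addr_ge0.
apply: (bM (`|M| + 1)); first by rewrite ltr_pwDr// ler_norm.
by exists x.
Qed.

End smooth.

(** * The scalar L^2 product and the H^1 norm *)

Section L2_product.
Context {R : realType} {d : nat} (Omega : lipschitz_domain R d).
Local Notation V := 'rV[R]_d.
Local Notation leb := (lebesgue_rV d).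
Local Notation L2 := (in_L2 leb Omega).
Local Notation ip := (dotL2s Omega).
Implicit Types (f g h : V -> R) (phi psi : V -> R).

Lemma dotL2sC f g : ip f g = ip g f.
Proof. by apply: eq_Rintegral => x _; rewrite mulrC. Qed.

Lemma dotL2s_lin (a : R) f g h : L2 f -> L2 g -> L2 h ->
  ip (fun x => a * f x + g x) h = a * ip f h + ip g h.
Proof.
move=> fL gL hL; have mO := domain_measurable Omega.
have fh := in_L2_integrableM fL hL; have gh := in_L2_integrableM gL hL.
rewrite /dotL2s -RintegralZl// -RintegralD//.
  by apply: eq_Rintegral => x _; ring.
exact: (integrableZl mO a fh).
Qed.

Lemma dotL2s_linr (a : R) f g h : L2 f -> L2 g -> L2 h ->
  ip h (fun x => a * f x + g x) = a * ip h f + ip h g.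
Proof. by move=> *; rewrite dotL2sC dotL2s_lin// !(dotL2sC h). Qed.

Lemma dotL2s_ge0 f : 0 <= ip f f.
Proof. by apply: Rintegral_ge0 => x _; rewrite -expr2 sqr_ge0. Qed.

Lemma dotL2s_sqr_lin (a : R) f g : L2 f -> L2 g ->
  ip (fun x => a * f x + g x) (fun x => a * f x + g x) =
  a ^+ 2 * ip f f + 2 * a * ip f g + ip g g.
Proof.
move=> fL gL; have fg := in_L2D a fL gL.
rewrite dotL2s_lin// !dotL2s_linr// (dotL2sC g f); ring.
Qed.

Lemma dotL2s_sqr_le f g : L2 f -> L2 g -> ip f g ^+ 2 <= ip f f * ip g g.
Proof.
move=> fL gL.
have H a : 0 <= a ^+ 2 * ip f f + 2 * a * ip f g + ip g g.
  by rewrite -dotL2s_sqr_lin// dotL2s_ge0.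
have := dotL2s_ge0 f; rewrite le_eqVlt => /predU1P[f0|f0].
  rewrite -f0 mul0r; have [->|fg0] := eqVneq (ip f g) 0; first by rewrite expr0n.
  (* When [ip f f] is zero the quadratic is affine in [a]; at this point it would equal -1. *)
  have := H (- (ip g g + 1) / (2 * ip f g)); rewrite -f0 mulr0 add0r.
  have -> : 2 * (- (ip g g + 1) / (2 * ip f g)) * ip f g = - (ip g g + 1).
    by field.
  lra.
(* The minimiser of the quadratic. *)
have := H (- ip f g / ip f f).
rewrite -(pmulr_rge0 _ f0).
have -> : ip f f * ((- ip f g / ip f f) ^+ 2 * ip f f +
    2 * (- ip f g / ip f f) * ip f g + ip g g) =
    ip f f * ip g g - ip f g ^+ 2 by field; rewrite gt_eqF.
by rewrite subr_ge0.
Qed.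

Definition normL2s f := Num.sqrt (ip f f).

Lemma normL2s_ge0 f : 0 <= normL2s f.
Proof. exact: sqrtr_ge0. Qed.

Lemma dotL2s_norm_le f g : L2 f -> L2 g -> `|ip f g| <= normL2s f * normL2s g.
Proof.
move=> fL gL; rewrite -sqrtr_sqr /normL2s -sqrtrM ?dotL2s_ge0//.
by rewrite ler_wsqrtr// dotL2s_sqr_le.
Qed.

Lemma normL2s_le f (a : R) : 0 <= a -> ip f f <= a ^+ 2 -> normL2s f <= a.
Proof.
by move=> a0 fa; rewrite -(ger0_norm a0) -sqrtr_sqr ler_wsqrtr.
Qed.

Lemma in_L2_mulb (m f : V -> R) (M : R) :
  measurable_fun (Omega : set V) m -> (forall x, `|m x| <= M) -> L2 f ->
  L2 (fun x => m x * f x).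
Proof.
move=> mm mM [mf if2]; have mO := domain_measurable Omega.
split; first exact: measurable_funM.
apply: (le_integrable mO _ _ (integrableZl mO (M ^+ 2) if2)).
  by apply/measurable_EFinP/measurable_funX/measurable_funM.
move=> x _ /=; rewrite lee_fin.
have M0 : 0 <= M := le_trans (normr_ge0 _) (mM x).
have -> : `|(m x * f x) ^+ 2| = (m x * f x) ^+ 2 by rewrite ger0_norm ?sqr_ge0.
rewrite ger0_norm; last by apply: mulr_ge0; exact: sqr_ge0.
rewrite exprMn ler_wpM2r ?sqr_ge0// -real_normK ?num_real//.
by rewrite ler_sqr ?nnegrE.
Qed.

Lemma test_in_L2 phi : test_function Omega phi -> L2 phi.
Proof. by case=> sphi _; apply/continuous_in_L2/smooth_continuous. Qed.

Lemma test_pderiv_in_L2 phi i : test_function Omega phi -> L2 (pderiv i phi).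
Proof. by case=> sphi _; apply/continuous_in_L2/smooth_pderiv_continuous. Qed.

Definition h1norm2 (f : V -> R) (g : 'I_d -> V -> R) : R :=
  \int[leb]_(x in Omega) h1sq f g x.

Lemma h1norm2_ge0 f (g : 'I_d -> V -> R) : 0 <= h1norm2 f g.
Proof. by apply: Rintegral_ge0 => x _; exact: h1sq_ge0. Qed.

Section h1.
Variables (f : V -> R) (g : 'I_d -> V -> R).
Hypotheses (fL : L2 f) (gL : forall i, L2 (g i)).

Lemma integrable_h1sq : leb.-integrable Omega (fun x => (h1sq f g x)%:E).
Proof.
have mO := domain_measurable Omega.
rewrite (_ : (fun x => _) =
    (fun x => (f x ^+ 2)%:E + \sum_i (g i x ^+ 2)%:E)%E); last first.
  by apply/funext => x; rewrite EFinD sumEFin.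
apply: (integrableD mO fL.2); apply: (integrable_sum mO) => i _.
exact: (gL i).2.
Qed.

Lemma dotL2s_le_h1 : ip f f <= h1norm2 f g.
Proof.
have mO := domain_measurable Omega.
apply: le_Rintegral => //; [exact: in_L2_integrableM|exact: integrable_h1sq|].
by move=> x _; rewrite -expr2 lerDl sumr_ge0// => i _; exact: sqr_ge0.
Qed.

Lemma dotL2s_grad_le_h1 i : ip (g i) (g i) <= h1norm2 f g.
Proof.
have mO := domain_measurable Omega.
apply: le_Rintegral => //; [exact: in_L2_integrableM|exact: integrable_h1sq|].
by move=> x _; rewrite -expr2 le_h1sq_grad.
Qed.

Lemma h1norm2E : (h1norm2 f g)%:E = (\int[leb]_(x in Omega) (h1sq f g x)%:E)%E.
Proof.
have mO := domain_measurable Omega.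
rewrite fineK//; apply: integrable_fin_num => //; exact: integrable_h1sq.
Qed.

End h1.

(** A triangle inequality for squared norms, from the pointwise [key], whose two sides differ by
    [(2 * a - b) ^+ 2]. *)
Lemma h1norm2_le_add f f' (g g' : 'I_d -> V -> R) : L2 f -> (forall i, L2 (g i)) ->
  L2 f' -> (forall i, L2 (g' i)) ->
  h1norm2 f' g' <= 2 * h1norm2 f g +
     2 * h1norm2 (fun x => f x - f' x) (fun i x => g i x - g' i x).
Proof.
move=> fL gL fL' gL'; have mO := domain_measurable Omega.
have subL a b : L2 a -> L2 b -> L2 (fun x => a x - b x).
  move=> aL bL; rewrite (_ : (fun x => _) = (fun x => -1 * b x + a x)).
    exact: in_L2D.
  by apply/funext => x; ring.
have i0 := integrable_h1sq fL' gL'; have i1 := integrable_h1sq fL gL.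
have i2 := integrable_h1sq fL' gL'.
have i3 : leb.-integrable Omega (fun x =>
    (h1sq (fun x => f x - f' x) (fun i x => g i x - g' i x) x)%:E).
  by apply: integrable_h1sq => [|i]; exact: subL.
have key (a b : R) : b ^+ 2 <= 2 * a ^+ 2 + 2 * (a - b) ^+ 2.
  rewrite -subr_ge0 (_ : _ - _ = (2 * a - b) ^+ 2) ?sqr_ge0//; ring.
rewrite /h1norm2 -!RintegralZl// -RintegralD//.
- apply: le_Rintegral => //.
    exact: (integrableD mO (integrableZl mO 2 i1) (integrableZl mO 2 i3)).
  move=> x _; rewrite /h1sq !mulrDr addrACA; apply: lerD => //.
  by rewrite !mulr_sumr -big_split; apply: ler_sum => i _; exact: key.
- exact: (integrableZl mO 2 i1).
- exact: (integrableZl mO 2 i3).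
Qed.

Lemma integral_Omega_out (F : V -> \bar R) : (forall x, ~ (Omega : set V) x -> F x = 0%E) ->
  (\int[leb]_(x in Omega) F x = \int[leb]_x F x)%E.
Proof.
move=> F0; rewrite integral_mkcond; congr (integral _ _ _); apply/funext => x.
by rewrite patchE; case: ifPn => // /negP xO; rewrite F0// => /mem_set.
Qed.

(** Test functions and their derivatives vanish off [Omega], so integrals over [Omega] and over the
    whole space agree and [ladyzhenskaya] applies. *)
Lemma test_mul_bound phi psi (s t : R) : d = 2%N \/ d = 3%N ->
  test_function Omega phi -> test_function Omega psi -> 0 < s -> 0 < t ->
  h1norm2 phi (pderiv^~ phi) <= s -> h1norm2 psi (pderiv^~ psi) <= t ->
  ip (fun x => phi x * psi x) (fun x => phi x * psi x) <= 4 * s * t.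
Proof.
move=> d23 tphi tpsi s0 t0 Hs Ht.
have key g u : test_function Omega g -> h1norm2 g (pderiv^~ g) <= u ->
    (\int[leb]_x (h1sq g (pderiv^~ g) x)%:E <= u%:E)%E.
  move=> tg gu; rewrite -integral_Omega_out.
    rewrite -h1norm2E ?lee_fin//; first exact: test_in_L2.
    by move=> i; exact: test_pderiv_in_L2.
  move=> x Ox; rewrite /h1sq (test_out tg)// expr0n add0r big1// => i _.
  by rewrite (test_pderiv_out i tg)// expr0n.
have := ladyzhenskaya d23 tphi tpsi s0 t0 (key _ _ tphi Hs) (key _ _ tpsi Ht).
rewrite -integral_Omega_out; last first.
  by move=> x Ox; rewrite (test_out tphi)// expr0n mul0r.
have pL := test_in_L2 (test_function_mul tphi tpsi).
have ipp := in_L2_integrableM pL pL.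
rewrite -lee_fin fineK; last first.
  by apply: integrable_fin_num => //; exact: domain_measurable.
rewrite (eq_integral (fun x => (phi x ^+ 2 * psi x ^+ 2)%:E))// => x _.
by rewrite -expr2 exprMn.
Qed.

End L2_product.

(** * Approximation by test functions *)

Section H10.
Context {R : realType} {d : nat} (Omega : lipschitz_domain R d).
Local Notation V := 'rV[R]_d.
Local Notation leb := (lebesgue_rV d).
Local Notation L2 := (in_L2 leb Omega).
Local Notation ip := (dotL2s Omega).
Local Notation nH := (h1norm2 Omega).
Local Notation test := (test_function (Omega : set V)).

(** The restriction to [e <= 1] lets quadratic errors be counted as linear ones. *)
Lemma le_of_eps (x a c : R) : (forall e, 0 < e -> e <= 1 -> x <= a + c * e) ->
  x <= a.
Proof.
move=> H; apply/ler_addgt0Pr => e e0.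
have c1 : 0 < `|c| + 1 by rewrite ltr_pwDr.
pose t := Num.min 1 (e / (`|c| + 1)).
have t0 : 0 < t by rewrite lt_min ltr01 divr_gt0.
apply: le_trans (H t t0 _) _; first by rewrite ge_min lexx.
rewrite lerD2l; apply: (@le_trans _ _ ((`|c| + 1) * t)).
  by rewrite ler_pM2r// (le_trans (ler_norm _))// lerDl.
have : t <= e / (`|c| + 1) by rewrite ge_min lexx orbT.
by rewrite ler_pdivlMr// mulrC.
Qed.

Lemma in_L2B (f g : V -> R) : L2 f -> L2 g -> L2 (fun x => f x - g x).
Proof.
move=> fL gL; rewrite (_ : (fun x => _) = (fun x => -1 * g x + f x)).
  exact: in_L2D.
by apply/funext => x; ring.
Qed.

(* A square integrable function [u] with a candidate gradient [g], approximable
   by test functions; weak derivatives are not mentioned, so that test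
   functions and [u - phi] qualify without any integration by parts. *)
Definition H10_pair (u : V -> R) (g : 'I_d -> V -> R) :=
  [/\ L2 u, forall i, L2 (g i) &
    forall e : R, 0 < e -> exists2 phi, test phi &
      nH (fun x => u x - phi x) (fun i x => g i x - pderiv i phi x) < e ^+ 2].

Lemma H10_pairP (u : H1 Omega) : H10 u ->
  H10_pair u (fun i x => grad u x 0 i).
Proof.
case: u => -[u Du] uH H10u; have /asboolP[/= uL DuL] := uH.
by split => // i; case: (DuL i).
Qed.

Lemma H10_pairB u g phi : H10_pair u g -> test phi ->
  H10_pair (fun x => u x - phi x) (fun i x => g i x - pderiv i phi x).
Proof.
move=> [uL gL ug] tphi; split => [|i|e e0].
- exact: in_L2B uL (test_in_L2 tphi).
- exact: in_L2B (gL i) (test_pderiv_in_L2 i tphi).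
have [psi tpsi psie] := ug e e0.
(* Subtracting [phi] from both [u] and its approximation [psi] leaves the error unchanged. *)
exists (fun x => -1 * phi x + psi x); first exact: test_function_lin.
apply: le_lt_trans psie; rewrite le_eqVlt; apply/predU1P; left.
apply: eq_Rintegral => x _; rewrite /h1sq; congr (_ + _).
  by congr (_ ^+ 2); ring.
apply: eq_bigr => i _; rewrite pderiv_lin; last 2 first.
- exact: test_differentiable tphi.
- exact: test_differentiable tpsi.
by congr (_ ^+ 2); ring.
Qed.

(** For a bounded multiplier, closeness of [phi] to [u] in L^2 suffices to transfer a bound from
    [m * phi] to [m * u]. *)
Lemma dotL2s_mul_approx (m u phi : V -> R) (b : R) :
  measurable_fun (Omega : set V) m -> (forall x, `|m x| <= b) ->
  L2 u -> L2 phi ->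
  ip (fun x => m x * u x) (fun x => m x * u x) <=
  2 * ip (fun x => m x * phi x) (fun x => m x * phi x) +
  2 * b ^+ 2 * ip (fun x => u x - phi x) (fun x => u x - phi x).
Proof.
move=> mm mb uL pL; have mO := domain_measurable Omega.
have rL := in_L2B uL pL.
have muL := in_L2_mulb mm mb uL; have mpL := in_L2_mulb mm mb pL.
have i1 := in_L2_integrableM mpL mpL; have i2 := in_L2_integrableM rL rL.
rewrite /dotL2s -!RintegralZl// -RintegralD//.
- apply: le_Rintegral => //.
  + exact: (in_L2_integrableM muL muL).
  + exact: (integrableD mO (integrableZl mO 2 i1) (integrableZl mO (2 * b ^+ 2) i2)).
  move=> x _.
  have mbx : m x ^+ 2 <= b ^+ 2.
    rewrite -(@real_normK _ (m x)) ?num_real// ler_sqr ?nnegrE//.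
    exact: le_trans (mb x).
  apply: (@le_trans _ _ (2 * (m x * phi x * (m x * phi x)) +
     2 * m x ^+ 2 * ((u x - phi x) * (u x - phi x)))); last first.
    rewrite lerD2l -expr2 ler_wpM2r ?sqr_ge0// ler_wpM2l//.
  rewrite -subr_ge0 [leRHS](_ : _ = (m x * (u x - 2 * phi x)) ^+ 2) ?sqr_ge0//.
  ring.
- exact: (integrableZl mO 2 i1).
- exact: (integrableZl mO (2 * b ^+ 2) i2).
Qed.

Hypothesis d23 : d = 2%N \/ d = 3%N.

Lemma h1norm2_approx u g phi (e : R) : H10_pair u g -> test phi ->
  nH (fun x => u x - phi x) (fun i x => g i x - pderiv i phi x) < e ^+ 2 ->
  nH phi (pderiv^~ phi) <= 2 * nH u g + 2 * e ^+ 2.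
Proof.
move=> [uL gL _] tphi ue.
apply: le_trans (h1norm2_le_add uL gL (test_in_L2 tphi)
  (fun i => test_pderiv_in_L2 i tphi)) _.
by rewrite lerD2l ler_pM2l// ltW.
Qed.

Lemma dotL2s_approx u g phi (e : R) : H10_pair u g -> test phi ->
  nH (fun x => u x - phi x) (fun i x => g i x - pderiv i phi x) < e ^+ 2 ->
  ip (fun x => u x - phi x) (fun x => u x - phi x) <= e ^+ 2 /\
  forall i, ip (fun x => g i x - pderiv i phi x)
               (fun x => g i x - pderiv i phi x) <= e ^+ 2.
Proof.
move=> [uL gL _] tphi ue.
have rL := in_L2B uL (test_in_L2 tphi).
have sL i := in_L2B (gL i) (test_pderiv_in_L2 i tphi).
split=> [|i]; apply: le_trans (ltW ue); first exact: dotL2s_le_h1.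
exact: (@dotL2s_grad_le_h1 _ _ Omega (fun x => u x - phi x)
  (fun i x => g i x - pderiv i phi x)).
Qed.

(** First density step: [psi] is bounded, hence an admissible multiplier, while [v] is approximated.
    The constant is 4 times a factor 2 from each of [dotL2s_mul_approx] and [h1norm2_approx]. *)
Lemma mul_test_bound v h psi (t : R) : H10_pair v h -> test psi -> 0 < t ->
  nH psi (pderiv^~ psi) <= t ->
  ip (fun x => psi x * v x) (fun x => psi x * v x) <= 16 * nH v h * t.
Proof.
move=> vH tpsi t0 Ht; have [vL hL vh] := vH.
have [M M0 bM] := test_bounded tpsi.
apply: (@le_of_eps _ _ (16 * t + 2 * M ^+ 2)) => e e0 e1.
have [phi tphi phie] := vh e e0.
have mpsi : measurable_fun (Omega : set V) psi by case: (test_in_L2 tpsi).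
apply: le_trans (dotL2s_mul_approx mpsi bM vL (test_in_L2 tphi)) _.
have s0 : 0 < 2 * nH v h + 2 * e ^+ 2.
  by rewrite ltr_wpDl ?mulr_ge0 ?h1norm2_ge0// mulr_gt0// exprn_gt0.
have A := test_mul_bound d23 tpsi tphi t0 s0 Ht (h1norm2_approx vH tphi phie).
have [B _] := dotL2s_approx vH tphi phie.
have e2 : e ^+ 2 <= e by rewrite expr2 ler_piMr// ltW.
have M2 : 0 <= 2 * M ^+ 2 by rewrite mulr_ge0// sqr_ge0.
apply: (@le_trans _ _ (2 * (4 * t * (2 * nH v h + 2 * e ^+ 2)) + 2 * M ^+ 2 * e ^+ 2)).
  by apply: lerD; [rewrite ler_pM2l|exact: ler_wpM2l].
rewrite [leLHS](_ : _ = 16 * nH v h * t + (16 * t + 2 * M ^+ 2) * e ^+ 2); last by ring.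
by rewrite lerD2l ler_wpM2l// addr_ge0// mulr_ge0// ltW.
Qed.

End H10.

(** * Square integrable products, integration by parts and skew symmetry *)

Section H10_products.
Context {R : realType} {d : nat} (Omega : lipschitz_domain R d).
Hypothesis d23 : d = 2%N \/ d = 3%N.
Local Notation V := 'rV[R]_d.
Local Notation leb := (lebesgue_rV d).
Local Notation L2 := (in_L2 leb Omega).
Local Notation ip := (dotL2s Omega).
Local Notation nl2 := (normL2s Omega).
Local Notation nH := (h1norm2 Omega).
Local Notation test := (test_function (Omega : set V)).
Local Notation H10p := (H10_pair Omega).

Lemma EFin_dotL2s (f : V -> R) : L2 f ->
  (ip f f)%:E = (\int[leb]_(x in Omega) (f x ^+ 2)%:E)%E.
Proof.
move=> fL; have mO := domain_measurable Omega.
rewrite fineK; last by apply: integrable_fin_num => //; exact: in_L2_integrableM.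
by apply: eq_integral => x _; rewrite expr2.
Qed.

(* The truncation of [v] is bounded, hence an admissible multiplier when the
   approximations of [u] converge in L^2 only. *)
Lemma mul_clip_bound u v g h (k : R) : 0 <= k -> H10p u g -> H10p v h ->
  let m x := Num.min k `|v x| in
  L2 (fun x => m x * u x) /\
  ip (fun x => m x * u x) (fun x => m x * u x) <= 64 * nH v h * nH u g.
Proof.
move=> k0 uH vH m; have [uL gL uapprox] := uH; have [vL hL _] := vH.
have mO := domain_measurable Omega.
have mm : measurable_fun (Omega : set V) m.
  apply: measurable_minr => //; apply: measurableT_comp => //; exact: vL.1.
have m0 x : 0 <= m x by rewrite le_min k0 normr_ge0.
have mk x : `|m x| <= k by rewrite ger0_norm// ge_min lexx.
have mv x : m x <= `|v x| by rewrite ge_min lexx orbT.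
split; first exact: in_L2_mulb mm mk uL.
apply: (@le_of_eps _ _ _ (64 * nH v h + 2 * k ^+ 2)) => e e0 e1.
have [psi tpsi psie] := uapprox e e0.
have pL := test_in_L2 tpsi.
apply: le_trans (dotL2s_mul_approx mm mk uL pL) _.
have t0 : 0 < 2 * nH u g + 2 * e ^+ 2.
  by rewrite ltr_wpDl ?mulr_ge0 ?h1norm2_ge0// mulr_gt0// exprn_gt0.
have A := mul_test_bound d23 vH tpsi t0 (h1norm2_approx uH tpsi psie).
have [B _] := dotL2s_approx uH tpsi psie.
have [M M0 bM] := test_bounded tpsi.
(* The truncation is at most [|v|], so the bound for a test function times [v] controls [m * psi]
   independently of [k]. *)
have C : ip (fun x => m x * psi x) (fun x => m x * psi x) <=
    ip (fun x => psi x * v x) (fun x => psi x * v x).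
  have mpL := in_L2_mulb mm mk pL; have pvL := in_L2_mulb pL.1 bM vL.
  apply: le_Rintegral => //; [exact: in_L2_integrableM|exact: in_L2_integrableM|].
  move=> x _; rewrite -!expr2 !exprMn mulrC ler_wpM2l ?sqr_ge0//.
  by rewrite -(@real_normK _ (v x)) ?num_real// ler_sqr ?nnegrE.
have e2 : e ^+ 2 <= e by rewrite expr2 ler_piMr// ltW.
apply: (@le_trans _ _ (2 * (16 * nH v h * (2 * nH u g + 2 * e ^+ 2)) +
   2 * k ^+ 2 * e ^+ 2)).
  apply: lerD; first by rewrite ler_pM2l// (le_trans C).
  by apply: ler_wpM2l => //; rewrite mulr_ge0// sqr_ge0.
rewrite [leLHS](_ : _ = 64 * nH v h * nH u g +
  (64 * nH v h + 2 * k ^+ 2) * e ^+ 2); last by ring.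
rewrite lerD2l ler_wpM2l// addr_ge0// mulr_ge0//; first exact: h1norm2_ge0.
exact: sqr_ge0.
Qed.

(** The bound of [mul_clip_bound] does not depend on the truncation level, so monotone convergence
    passes it to the limit. *)
Lemma H10_pair_mul u v g h : H10p u g -> H10p v h ->
  L2 (fun x => v x * u x) /\
  ip (fun x => v x * u x) (fun x => v x * u x) <= 64 * nH v h * nH u g.
Proof.
move=> uH vH; have [uL gL _] := uH; have [vL hL _] := vH.
have mO := domain_measurable Omega.
pose m (n : nat) x := Num.min n%:R `|v x|.
have mb n := mul_clip_bound (ler0n R n) uH vH.
pose F n x := ((m n x * u x) ^+ 2)%:E.
have mF n : measurable_fun (Omega : set V) (F n).
  by apply/measurable_EFinP/measurable_funX; case: (mb n) => -[].
have F0 n x : (Omega : set V) x -> (0 <= F n x)%E by rewrite lee_fin sqr_ge0.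
have m0 n x : 0 <= m n x by rewrite le_min ler0n normr_ge0.
have ndF x : (Omega : set V) x -> {homo F ^~ x : n p / (n <= p)%N >-> (n <= p)%E}.
  move=> _ n p np; rewrite lee_fin !exprMn ler_wpM2r ?sqr_ge0//.
  by rewrite ler_sqr ?nnegrE// le_min2// ler_nat.
have FE x : limn (F ^~ x) = ((v x * u x) ^+ 2)%:E.
  (* At fixed [x] the sequence is stationary once [n] exceeds [|v x|]. *)
  apply: lim_near_cst => //; near=> n; rewrite /F /m min_r; last first.
    by near: n; exact: nbhs_infty_ger.
  by rewrite !exprMn real_normK ?num_real.
have vuM : measurable_fun (Omega : set V) (fun x => v x * u x).
  by apply: measurable_funM; [exact: vL.1|exact: uL.1].
have bound : (\int[leb]_(x in Omega) ((v x * u x) ^+ 2)%:E <=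
    (64 * nH v h * nH u g)%:E)%E.
  rewrite (_ : \int[leb]_(x in Omega) _ = \int[leb]_(x in Omega) limn (F ^~ x))%E; last first.
    by apply: eq_integral => x _; rewrite FE.
  rewrite monotone_convergence//; apply: lime_le.
    apply: ereal_nondecreasing_is_cvgn => n p np.
    apply: (ge0_le_integral _ mO (F0 n) (mF n) (mF p)) => x Ox.
    exact: ndF np.
  apply: nearW => n; have [mL mle] := mb n.
  by rewrite -[X in (X <= _)%E](EFin_dotL2s mL) lee_fin.
have vuL : L2 (fun x => v x * u x).
  split => //; apply/integrableP; split.
    by apply/measurable_EFinP/measurable_funX.
  rewrite (eq_integral (fun x => ((v x * u x) ^+ 2)%:E)).
    exact: le_lt_trans bound (ltry _).
  by move=> x _; rewrite /= ger0_norm ?sqr_ge0.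
by split => //; rewrite -lee_fin EFin_dotL2s.
Unshelve. all: by end_near. Qed.

Lemma normL2s_mul_le u v g h (e : R) : 0 <= e -> H10p u g -> H10p v h ->
  nH u g <= e ^+ 2 -> nl2 (fun x => v x * u x) <= 8 * Num.sqrt (nH v h) * e.
Proof.
move=> e0 uH vH ue; have [_ vule] := H10_pair_mul uH vH.
apply: normL2s_le; first by rewrite !mulr_ge0 ?sqrtr_ge0.
apply: le_trans vule _; rewrite !exprMn sqr_sqrtr ?h1norm2_ge0//.
rewrite (_ : 8 ^+ 2 = 64); last by ring.
by rewrite ler_wpM2l// mulr_ge0// h1norm2_ge0.
Qed.

Lemma eq0_of_eps (z c : R) :
  (forall e, 0 < e -> e <= 1 -> `|z| <= c * e) -> z = 0.
Proof.
move=> H; apply/eqP; rewrite -normr_le0.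
by apply: (@le_of_eps _ _ _ c) => e e0 e1; rewrite add0r; exact: H.
Qed.

(** For a test function this is the definition of the weak derivative of [q]; both sides are
    continuous in [w] for the H^1 norm. *)
Lemma H10_integration_by_parts (q w : H1 Omega) (i : 'I_d) : H10 w ->
  ip q (fun x => grad w x 0 i) = - ip (fun x => grad q x 0 i) w.
Proof.
move=> /H10_pairP wH; have [wL DwL wapprox] := wH.
have [qL Dq] : L2 q /\ forall i, L2 (fun x => grad q x 0 i) /\
    weak_partial Omega i q (fun x => grad q x 0 i).
  by case: (q) => -[? ?] qH; have /asboolP[] := qH.
have [DqL wq] := Dq i; have DwiL := DwL i.
apply/eqP; rewrite -addr_eq0; apply/eqP.
apply: (@eq0_of_eps _ (nl2 q + nl2 (fun x => grad q x 0 i))) => e e0 e1.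
have [phi tphi phie] := wapprox e e0.
have pL := test_in_L2 tphi; have DpL := test_pderiv_in_L2 i tphi.
have [rle sle] := dotL2s_approx wH tphi phie.
have rL := in_L2B wL pL; have sL := in_L2B DwiL DpL.
have IBP : ip q (pderiv i phi) = - ip (fun x => grad q x 0 i) phi by exact: wq.
have -> : ip q (fun x => grad w x 0 i) + ip (fun x => grad q x 0 i) w =
    ip q (fun x => grad w x 0 i - pderiv i phi x) +
    ip (fun x => grad q x 0 i) (fun x => w x - phi x).
  rewrite [X in X + _](_ : _ = ip q (fun x =>
      1 * (grad w x 0 i - pderiv i phi x) + pderiv i phi x)); last first.
    by apply: eq_Rintegral => x _; ring.
  rewrite [X in _ + X = _](_ : _ = ip (fun x => grad q x 0 i)
      (fun x => 1 * (w x - phi x) + phi x)); last first.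
    by apply: eq_Rintegral => x _; ring.
  by rewrite !dotL2s_linr// IBP; ring.
apply: le_trans (ler_normD _ _) _; rewrite mulrDl.
have nr := normL2s_le (ltW e0) rle; have ns := normL2s_le (ltW e0) (sle i).
apply: lerD; first exact: le_trans (dotL2s_norm_le qL sL) (ler_wpM2l (normL2s_ge0 _ _) ns).
exact: le_trans (dotL2s_norm_le DqL rL) (ler_wpM2l (normL2s_ge0 _ _) nr).
Qed.

(** The weak derivative of [v] is tested with [phi * phi], which is again a test function. *)
Lemma test_skew (v : H1 Omega) phi (j : 'I_d) : test phi ->
  ip (fun x => v x * phi x) (pderiv j phi) +
  1 / 2 * ip (fun x => grad v x 0 j) (fun x => phi x * phi x) = 0.
Proof.
move=> tphi.
have wv : weak_partial Omega j v (fun x => grad v x 0 j).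
  by case: (v) => -[? ?] vH; have /asboolP[_ /(_ j)[]] := vH.
have vL : L2 v by case: (v) => -[? ?] vH; have /asboolP[] := vH.
have dphi x : differentiable phi x := test_differentiable x tphi.
have Dphi2 : pderiv j (fun x => phi x * phi x) =
    fun x => phi x * pderiv j phi x + phi x * pderiv j phi x.
  by apply/funext => x; exact: pderiv_mul.
have := wv _ (test_function_mul tphi tphi); rewrite Dphi2.
rewrite -/(ip (fun x => grad v x 0 j) (fun x => phi x * phi x)).
have [M M0 bM] := test_bounded tphi.
have pL := test_in_L2 tphi.
have DpL := test_pderiv_in_L2 j tphi.
have vpL : L2 (fun x => v x * phi x).
  by rewrite (_ : (fun x => _) = (fun x => phi x * v x));
    [exact: in_L2_mulb pL.1 bM vL|apply/funext => x; rewrite mulrC].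
have -> : \int[leb]_(x in Omega)
    (v x * (phi x * pderiv j phi x + phi x * pderiv j phi x)) =
    2 * ip (fun x => v x * phi x) (pderiv j phi).
  rewrite /dotL2s -RintegralZl//; first by apply: eq_Rintegral => x _; ring.
    exact: domain_measurable.
  exact: in_L2_integrableM vpL DpL.
lra.
Qed.

(** Only [u] is approximated, by a test function [phi] satisfying [test_skew]. Every error term
    contains [r] or [s], and the product estimate makes it of order [e]. *)
Lemma H10_skew (u v : H1 Omega) (j : 'I_d) : H10 u -> H10 v ->
  ip (fun x => v x * u x) (fun x => grad u x 0 j) +
  1 / 2 * ip (fun x => grad v x 0 j) (fun x => u x * u x) = 0.
Proof.
move=> /H10_pairP uH /H10_pairP vH.
have [uL DuL uapprox] := uH; have [vL DvL _] := vH.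
pose Du x := grad u x 0 j; pose Dv x := grad v x 0 j.
have DujL : L2 Du := DuL j; have DvjL : L2 Dv := DvL j.
have [vuL _] := H10_pair_mul uH vH; have [uuL _] := H10_pair_mul uH uH.
pose Nv := Num.sqrt (nH v (fun i x => grad v x 0 i)).
pose Nu := Num.sqrt (nH u (fun i x => grad u x 0 i)).
have Nv0 : 0 <= Nv := sqrtr_ge0 _.
have Nu0 : 0 <= Nu := sqrtr_ge0 _.
apply: (@eq0_of_eps _ (8 * Nv * nl2 Du + nl2 (fun x => v x * u x) + 8 * Nv +
  8 * nl2 Dv * Nu + 8 * nl2 Dv)) => e e0 e1.
have [phi tphi phie] := uapprox e e0.
have pL := test_in_L2 tphi; have DpL := test_pderiv_in_L2 j tphi.
have rH := H10_pairB uH tphi.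
pose r x := u x - phi x; pose s x := Du x - pderiv j phi x.
have sL : L2 s := in_L2B DujL DpL.
have [vrL _] := H10_pair_mul rH vH; have [urL _] := H10_pair_mul rH uH.
have [rrL _] := H10_pair_mul rH rH.
have [_ /(_ j) sle] := dotL2s_approx uH tphi phie.
have ns : nl2 s <= e := normL2s_le (ltW e0) sle.
have nvr := normL2s_mul_le (ltW e0) rH vH (ltW phie).
have nur := normL2s_mul_le (ltW e0) rH uH (ltW phie).
have nrr : nl2 (fun x => r x * r x) <= 8 * e * e.
  apply: le_trans (normL2s_mul_le (ltW e0) rH rH (ltW phie)) _.
  apply: ler_wpM2r; first exact: ltW.
  rewrite ler_pM2l// -[leRHS](ger0_norm (ltW e0)) -sqrtr_sqr.
  exact: ler_wsqrtr (ltW phie).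
have key := test_skew v j tphi.
have E1 : ip (fun x => v x * u x) Du = ip (fun x => v x * r x) Du +
    ip (fun x => v x * u x) s - ip (fun x => v x * r x) s +
    ip (fun x => v x * phi x) (pderiv j phi).
  have bL : L2 (fun x => v x * phi x).
    rewrite (_ : (fun x => _) = (fun x => v x * u x - v x * r x)).
      exact: in_L2B.
    by apply/funext => x; rewrite /r; ring.
  have vuE h : L2 h -> ip (fun x => v x * u x) h =
      ip (fun x => v x * r x) h + ip (fun x => v x * phi x) h.
    move=> hL; rewrite -[X in X + _]mul1r -dotL2s_lin//.
    by apply: eq_Rintegral => x _; rewrite /r; ring.
  have DuE : ip (fun x => v x * phi x) Du =
      ip (fun x => v x * phi x) s + ip (fun x => v x * phi x) (pderiv j phi).
    rewrite -[X in X + _]mul1r -dotL2s_linr//.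
    by apply: eq_Rintegral => x _; rewrite /s; ring.
  by rewrite (vuE _ DujL) (vuE _ sL) DuE; ring.
have E2 : ip Dv (fun x => u x * u x) = 2 * ip Dv (fun x => u x * r x) -
    ip Dv (fun x => r x * r x) + ip Dv (fun x => phi x * phi x).
  have ppL := test_in_L2 (test_function_mul tphi tphi).
  transitivity (ip Dv (fun x => 2 * (u x * r x) +
      (-1 * (r x * r x) + phi x * phi x))).
    by apply: eq_Rintegral => x _; rewrite /r; ring.
  by rewrite dotL2s_linr ?dotL2s_linr//; [ring|exact: in_L2D].
rewrite -/Du -/Dv in key *.
(* The two terms in [phi] alone cancel by [key]; the five remaining ones are bounded by [C1] to
   [C5]. *)
have -> : ip (fun x => v x * u x) Du + 1 / 2 * ip Dv (fun x => u x * u x) =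
  ip (fun x => v x * r x) Du + ip (fun x => v x * u x) s -
  ip (fun x => v x * r x) s + ip Dv (fun x => u x * r x) -
  1 / 2 * ip Dv (fun x => r x * r x) by rewrite E1 E2; lra.
have B1 := dotL2s_norm_le vrL DujL; have B2 := dotL2s_norm_le vuL sL.
have B3 := dotL2s_norm_le vrL sL; have B4 := dotL2s_norm_le DvjL urL.
have B5 := dotL2s_norm_le DvjL rrL.
have ee : e * e <= e by rewrite ler_piMr// ltW.
have C1 : `|ip (fun x => v x * r x) Du| <= 8 * Nv * nl2 Du * e.
  by apply: le_trans B1 _; rewrite -mulrA (mulrC (nl2 Du)) mulrA ler_wpM2r// normL2s_ge0.
have C2 : `|ip (fun x => v x * u x) s| <= nl2 (fun x => v x * u x) * e.
  by apply: le_trans B2 _; rewrite ler_wpM2l// normL2s_ge0.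
have C3 : `|ip (fun x => v x * r x) s| <= 8 * Nv * e.
  apply: le_trans B3 _; apply: (@le_trans _ _ (8 * Nv * e * e)).
    by apply: ler_pM; rewrite ?normL2s_ge0.
  by rewrite -mulrA ler_wpM2l// mulr_ge0.
have C4 : `|ip Dv (fun x => u x * r x)| <= 8 * nl2 Dv * Nu * e.
  apply: le_trans B4 _; rewrite (mulrC 8) -!mulrA ler_wpM2l ?normL2s_ge0//.
  by rewrite mulrA.
have C5 : `|ip Dv (fun x => r x * r x)| <= 8 * nl2 Dv * e.
  apply: le_trans B5 _; rewrite (mulrC 8) -mulrA ler_wpM2l ?normL2s_ge0//.
  by apply: le_trans nrr _; rewrite -mulrA ler_wpM2l.
have Dv0 : 0 <= nl2 Dv * e by rewrite mulr_ge0 ?normL2s_ge0// ltW.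
move: C1 C2 C3 C4 C5; rewrite !ler_norml.
move=> /andP[? ?] /andP[? ?] /andP[? ?] /andP[? ?] /andP[? ?].
by apply/andP; split; lra.
Qed.

End H10_products.

(** * Bilinear forms on vector fields *)

Section vector_forms.
Context {R : realType} {d : nat} (Omega : lipschitz_domain R d).
Local Notation V := 'rV[R]_d.
Local Notation leb := (lebesgue_rV d).
Local Notation L2 := (in_L2 leb Omega).
Local Notation ip := (dotL2s Omega).
Local Notation dotmx := Defs.dotmx.

Lemma H1_funD (a b : H1 Omega) x : (a + b) x = a x + b x. Proof. by []. Qed.

Lemma H1_funN (a : H1 Omega) x : (- a) x = - a x. Proof. by []. Qed.

Lemma H1_funZ k (a : H1 Omega) x : (k *: a) x = k * a x. Proof. by []. Qed.

Lemma gradD (a b : H1 Omega) x : grad (a + b) x = grad a x + grad b x.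
Proof. by []. Qed.

Lemma gradN (a : H1 Omega) x : grad (- a) x = - grad a x. Proof. by []. Qed.

Lemma gradZ k (a : H1 Omega) x : grad (k *: a) x = k *: grad a x.
Proof. by []. Qed.

Lemma H1_in_L2 (q : H1 Omega) : L2 q.
Proof. by case: (q) => -[? ?] qH; have /asboolP[] := qH. Qed.

Lemma grad_in_L2 (q : H1 Omega) i : L2 (fun x => grad q x 0 i).
Proof. by case: (q) => -[? ?] qH; have /asboolP[_ /(_ i)[]] := qH. Qed.

Lemma Rintegral_sum (I : Type) (s : seq I) (F : I -> V -> R) :
  (forall i, leb.-integrable Omega (fun x => (F i x)%:E)) ->
  \int[leb]_(x in Omega) (\sum_(i <- s) F i x) =
  \sum_(i <- s) \int[leb]_(x in Omega) F i x.
Proof.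
move=> iF; have mO := domain_measurable Omega.
elim: s => [|i s IHs].
  under eq_Rintegral do rewrite big_nil.
  by rewrite big_nil /Rintegral integral0.
under eq_Rintegral do rewrite big_cons.
rewrite big_cons -IHs RintegralD//; first exact: iF.
rewrite (_ : EFin \o _ = fun x => (\sum_(i <- s) (F i x)%:E)%E).
  by apply: (integrable_sum mO) => i0 _; exact: iF.
by apply/funext => x; rewrite /= sumEFin.
Qed.

Lemma in_L2_sum (I : Type) (s : seq I) (F : I -> V -> R) :
  (forall i, L2 (F i)) -> L2 (fun x => \sum_(i <- s) F i x).
Proof.
move=> FL; elim: s => [|i s IHs].
  under eq_fun do rewrite big_nil.
  by apply: continuous_in_L2 => x; exact: cst_continuous.
rewrite (_ : (fun x => _) = fun x => 1 * F i x + \sum_(i <- s) F i x).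
  exact: in_L2D.
by apply/funext => x; rewrite big_cons mul1r.
Qed.

Lemma dotmx_rV (A B : V) : dotmx A B = \sum_i A 0 i * B 0 i.
Proof. by rewrite /Defs.dotmx big_ord1. Qed.

Lemma dotmxxE m n (A : 'M[R]_(m, n)) : dotmx A A = \sum_i \sum_j A i j ^+ 2.
Proof. by apply: eq_bigr => i _; apply: eq_bigr => j _; rewrite expr2. Qed.

Lemma dotmx_ge0 m n (A : 'M[R]_(m, n)) : 0 <= dotmx A A.
Proof.
by rewrite dotmxxE; do 2![apply: sumr_ge0 => ? _]; exact: sqr_ge0.
Qed.

Lemma dotL2_ge0 m n (F : V -> 'M[R]_(m, n)) : 0 <= dotL2 Omega F F.
Proof. by apply: Rintegral_ge0 => x _; exact: dotmx_ge0. Qed.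

Lemma normL2_sqr m n (F : V -> 'M[R]_(m, n)) :
  normL2 Omega F ^+ 2 = dotL2 Omega F F.
Proof. by rewrite sqr_sqrtr// dotL2_ge0. Qed.

Lemma dotL2_rVE (F G : V -> V) :
  (forall i, L2 (fun x => F x 0 i)) -> (forall i, L2 (fun x => G x 0 i)) ->
  dotL2 Omega F G = \sum_i ip (fun x => F x 0 i) (fun x => G x 0 i).
Proof.
move=> FL GL; rewrite /dotL2; under eq_Rintegral do rewrite dotmx_rV.
by rewrite Rintegral_sum// => i; exact: in_L2_integrableM.
Qed.

Lemma field_in_L2 (w : 'I_d -> H1 Omega) i : L2 (fun x => field w x 0 i).
Proof. by under eq_fun do rewrite mxE; exact: H1_in_L2. Qed.

Lemma dotL2_rVC (F G : V -> V) : dotL2 Omega F G = dotL2 Omega G F.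
Proof.
apply: eq_Rintegral => x _; rewrite !dotmx_rV.
by apply: eq_bigr => i _; rewrite mulrC.
Qed.

Lemma dotL2_rV_lin (F G H : V -> V) (a : R) :
  (forall i, L2 (fun x => F x 0 i)) -> (forall i, L2 (fun x => G x 0 i)) ->
  (forall i, L2 (fun x => H x 0 i)) ->
  dotL2 Omega (fun x => a *: F x + G x) H =
  a * dotL2 Omega F H + dotL2 Omega G H.
Proof.
move=> FL GL HL; rewrite !dotL2_rVE//; last first.
  by move=> i; under eq_fun do rewrite !mxE; exact: in_L2D.
rewrite mulr_sumr -big_split; apply: eq_bigr => i _ /=.
by under [LHS]eq_Rintegral do rewrite !mxE; exact: dotL2s_lin.
Qed.

Lemma dotL2_rV_sqr_lin (F G : V -> V) (a : R) :
  (forall i, L2 (fun x => F x 0 i)) -> (forall i, L2 (fun x => G x 0 i)) ->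
  dotL2 Omega (fun x => a *: F x + G x) (fun x => a *: F x + G x) =
  a ^+ 2 * dotL2 Omega F F + 2 * a * dotL2 Omega F G + dotL2 Omega G G.
Proof.
move=> FL GL.
have L i : L2 (fun x => (a *: F x + G x) 0 i).
  by under eq_fun do rewrite !mxE; exact: in_L2D.
rewrite dotL2_rV_lin// (dotL2_rVC F) (dotL2_rVC G) !dotL2_rV_lin//.
by rewrite (dotL2_rVC G F); ring.
Qed.

Lemma dotL2_rV_young (F G : V -> V) (a : R) :
  (forall i, L2 (fun x => F x 0 i)) -> (forall i, L2 (fun x => G x 0 i)) ->
  2 * a * dotL2 Omega F G <= a ^+ 2 * dotL2 Omega F F + dotL2 Omega G G.
Proof.
move=> FL GL; have := dotL2_ge0 (fun x => - a *: F x + G x).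
by rewrite dotL2_rV_sqr_lin//; lra.
Qed.

Lemma div_fieldE (w : 'I_d -> H1 Omega) x :
  div_field w x = \sum_i grad (w i) x 0 i.
Proof. by apply: eq_bigr => i _; rewrite mxE. Qed.

Lemma div_field_in_L2 (w : 'I_d -> H1 Omega) : L2 (div_field w).
Proof.
rewrite (_ : div_field w = fun x => \sum_i grad (w i) x 0 i).
  by apply: in_L2_sum => i; exact: grad_in_L2.
by apply/funext => x; exact: div_fieldE.
Qed.

Lemma dotL2s_div (q : V -> R) (w : 'I_d -> H1 Omega) : L2 q ->
  ip q (div_field w) = \sum_i ip q (fun x => grad (w i) x 0 i).
Proof.
move=> qL; rewrite /dotL2s; under eq_Rintegral do rewrite div_fieldE mulr_sumr.
rewrite Rintegral_sum// => i; apply: in_L2_integrableM => //; exact: grad_in_L2.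
Qed.

Lemma dotL2s_div_ibp (q : H1 Omega) (w : 'I_d -> H1 Omega) : H10_field w ->
  ip q (div_field w) = - dotL2 Omega (grad q) (field w).
Proof.
move=> wH; rewrite dotL2s_div; last exact: H1_in_L2.
rewrite dotL2_rVE; [|exact: grad_in_L2|exact: field_in_L2].
rewrite -sumrN; apply: eq_bigr => i _; rewrite (H10_integration_by_parts _ _ (wH i)).
by congr (- _); apply: eq_Rintegral => x _; rewrite mxE.
Qed.

(** The identity holds for each pair of components by [H10_skew]; square integrability of the
    products makes each term integrable, so that the sums leave the integrals. *)
Lemma convect_skew (u v : 'I_d -> H1 Omega) : d = 2%N \/ d = 3%N ->
  H10_field u -> H10_field v ->
  dotL2 Omega (convect u v) (field u) +
  1 / 2 * dotL2 Omega (fun x => div_field v x *: field u x) (field u) = 0.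
Proof.
move=> d23 uH vH; have mO := domain_measurable Omega.
have vuL i j : L2 (fun x => v j x * u i x).
  by have [] := H10_pair_mul d23 (H10_pairP (uH i)) (H10_pairP (vH j)).
have uuL i : L2 (fun x => u i x * u i x).
  by have [] := H10_pair_mul d23 (H10_pairP (uH i)) (H10_pairP (uH i)).
have i1 i j : leb.-integrable Omega
    (fun x => (v j x * u i x * grad (u i) x 0 j)%:E).
  by apply: in_L2_integrableM => //; exact: grad_in_L2.
have i2 i j : leb.-integrable Omega
    (fun x => (grad (v j) x 0 j * (u i x * u i x))%:E).
  by apply: in_L2_integrableM => //; exact: grad_in_L2.
have E1 : dotL2 Omega (convect u v) (field u) =
    \sum_i \sum_j ip (fun x => v j x * u i x) (fun x => grad (u i) x 0 j).
  transitivity (\int[leb]_(x in Omega)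
      \sum_i \sum_j v j x * u i x * grad (u i) x 0 j).
    apply: eq_Rintegral => x _; rewrite dotmx_rV; apply: eq_bigr => i _.
    rewrite /convect !mxE mulr_suml; apply: eq_bigr => j _; rewrite !mxE; ring.
  rewrite Rintegral_sum => [|i].
    by apply: eq_bigr => i _; rewrite Rintegral_sum.
  rewrite (_ : (fun x => _) = (fun x =>
    (\sum_j (v j x * u i x * grad (u i) x 0 j)%:E)%E)).
    by apply: (integrable_sum mO) => j _.
  by apply/funext => x; rewrite sumEFin.
have E2 : dotL2 Omega (fun x => div_field v x *: field u x) (field u) =
    \sum_i \sum_j ip (fun x => grad (v j) x 0 j) (fun x => u i x * u i x).
  transitivity (\int[leb]_(x in Omega)
      \sum_i \sum_j grad (v j) x 0 j * (u i x * u i x)).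
    apply: eq_Rintegral => x _; rewrite dotmx_rV; apply: eq_bigr => i _.
    by rewrite !mxE div_fieldE -mulrA mulr_suml.
  rewrite Rintegral_sum => [|i].
    by apply: eq_bigr => i _; rewrite Rintegral_sum.
  rewrite (_ : (fun x => _) = (fun x =>
    (\sum_j (grad (v j) x 0 j * (u i x * u i x))%:E)%E)).
    by apply: (integrable_sum mO) => j _.
  by apply/funext => x; rewrite sumEFin.
rewrite E1 E2 mulr_sumr -big_split big1// => i _ /=.
rewrite mulr_sumr -big_split big1// => j _ /=.
exact: H10_skew.
Qed.

Lemma dotL2_gradC (a b : H1 Omega) :
  dotL2 Omega (grad a) (grad b) = dotL2 Omega (grad b) (grad a).
Proof. exact: dotL2_rVC. Qed.

Lemma dotL2_gradB (a b c : H1 Omega) : dotL2 Omega (grad (a - b)) (grad c) =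
  dotL2 Omega (grad a) (grad c) - dotL2 Omega (grad b) (grad c).
Proof.
rewrite (_ : grad (a - b) = fun x => -1 *: grad b x + grad a x).
  by rewrite dotL2_rV_lin; [ring|exact: grad_in_L2..].
by apply/funext => x; rewrite gradD gradN scaleN1r addrC.
Qed.

Lemma dotL2_gradZ k (a b : H1 Omega) :
  dotL2 Omega (grad (k *: a)) (grad b) = k * dotL2 Omega (grad a) (grad b).
Proof.
have -> : grad (k *: a) = fun x => (k - 1) *: grad a x + grad a x.
  apply/funext => x; rewrite gradZ -[X in _ = _ + X]scale1r -scalerDl.
  by congr (_ *: _); ring.
by rewrite dotL2_rV_lin; [ring|exact: grad_in_L2..].
Qed.

Lemma mean_zero_lin k (a b : H1 Omega) : mean_zero a -> mean_zero b ->
  mean_zero (k *: a - b).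
Proof.
move=> ma mb; have mO := domain_measurable Omega.
have oneL : L2 (fun=> 1) by apply: continuous_in_L2 => x; exact: cst_continuous.
have E (q : H1 Omega) : mean_zero q <-> ip q (fun=> 1) = 0.
  by rewrite /mean_zero /dotL2s; under [in X in _ <-> X]eq_Rintegral do rewrite mulr1.
apply/E; move/E: ma => ma; move/E: mb => mb.
transitivity (ip (fun x => k * a x + (-1 * b x + 0)) (fun=> 1)).
  by apply: eq_Rintegral => x _; rewrite H1_funD H1_funZ H1_funN; ring.
have zL : L2 (fun=> 0) by apply: continuous_in_L2 => x; exact: cst_continuous.
have aL := H1_in_L2 a; have bL := H1_in_L2 b.
rewrite dotL2s_lin//; last exact: in_L2D.
rewrite dotL2s_lin// ma mb /dotL2s.
under eq_Rintegral do rewrite mul0r.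
by rewrite /Rintegral integral0 /= !mulr0 !addr0.
Qed.

Lemma mean_zero0 : mean_zero (0 : H1 Omega).
Proof.
rewrite /mean_zero (eq_Rintegral _ (g := fun=> 0))//.
by rewrite /Rintegral integral0.
Qed.

(** Serves for the divergence of the initial velocity, which vanishes only almost everywhere. *)
Lemma dotL2s_ae0 (q g : V -> R) : L2 q -> L2 g ->
  {ae leb, forall x, (Omega : set _) x -> g x = 0} -> ip q g = 0.
Proof.
move=> qL gL g0; have mO := domain_measurable Omega.
rewrite /dotL2s /Rintegral (ae_eq_integral (fun=> 0%E))//.
- by rewrite integral0.
- by apply/measurable_EFinP; apply: measurable_funM; [exact: qL.1|exact: gL.1].
by apply: filterS g0 => x /[swap] Ox /(_ Ox) ->; rewrite mulr0.
Qed.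

End vector_forms.

(** * Energy estimate *)

Section gronwall.
Context {R : realType}.

(** Adding the accumulated sum of [b] to the energy gives a quantity [Y] that grows by a factor of
    at most [c] per step, apart from the source. *)
Lemma discrete_gronwall (N : nat) (k : R) (a b F : nat -> R) :
  0 < k -> k < 1 -> N%:R * k = 1 ->
  (forall n, 0 <= a n) -> (forall n, 0 <= b n) -> (forall n, 0 <= F n) ->
  (forall n, (n < N)%N ->
     a n.+1 + b n.+1 <= a n + b n + F n.+1 + k * a n.+1) ->
  a N + b N + k * \sum_(1 <= n < N.+1) b n <=
  expR (1 / (1 - k)) * (a 0%N + b 0%N + \sum_(1 <= n < N.+1) F n).
Proof.
move=> k0 k1 Nk a0 b0 F0 step.
have k1' : 0 < 1 - k by rewrite subr_gt0.
pose c := (1 - k)^-1; have c1 : 1 <= c by rewrite invf_ge1// gerBl ltW.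
have c0 : 0 <= c by exact: le_trans c1.
pose Y n := a n + b n + k * \sum_(1 <= i < n.+1) b i.
pose S n := a 0%N + b 0%N + \sum_(1 <= i < n.+1) F i.
have S0 n : 0 <= S n by rewrite /S !addr_ge0// sumr_ge0.
have YS n : (n <= N)%N -> Y n <= c ^+ n * S n.
  elim: n => [_|n IHn nN].
    by rewrite /Y /S expr0 mul1r !big_geq// mulr0.
  (* The factor [1 - k] absorbs [k * a n.+1] and also removes [k * b n.+1], exactly the new term of
     the sum; the second order rest [kb] has a good sign. *)
  have Yn : (1 - k) * Y n.+1 <= Y n + F n.+1.
    have sb0 : 0 <= \sum_(1 <= i < n.+2) b i by exact: sumr_ge0.
    have := step n nN; move: sb0; rewrite /Y [in (k * \sum_(1 <= i < n.+2) b i)]big_nat_recr//=.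
    set s := \sum_(1 <= i < n.+1) b i => sb0.
    have kb : 0 <= k * (k * (s + b n.+1)).
      by rewrite !mulr_ge0 ?(ltW k0)// addr_ge0// sumr_ge0.
    lra.
  have -> : Y n.+1 = c * ((1 - k) * Y n.+1) by rewrite /c mulKf// gt_eqF.
  rewrite exprS -mulrA ler_wpM2l//; apply: le_trans Yn _.
  apply: (@le_trans _ _ (c ^+ n * S n + c ^+ n * F n.+1)).
    apply: lerD; first by apply: IHn; exact: ltnW.
    by rewrite ler_peMl// exprn_ege1.
  by rewrite -mulrDr /S [in leRHS]big_nat_recr//= addrA.
apply: le_trans (YS N (leqnn N)) _; apply: ler_wpM2r => //.
(* Since [N%:R * k = 1], it suffices to compare one factor: [c] equals [1 + k / (1 - k)]. *)
have -> : expR (1 / (1 - k)) = expR (k / (1 - k)) ^+ N.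
  by rewrite -expRM_natl mulrA Nk.
rewrite lerXn2r ?nnegrE ?expR_ge0//.
apply: le_trans (expR_ge1Dx _).
rewrite /c -[leLHS]mul1r -[X in X / _ <= _](subrK k) mulrDl divff ?gt_eqF//.
Qed.

End gronwall.

(** * The energy inequality over one time step *)

Section energy.
Context {R : realType} {d : nat} (Omega : lipschitz_domain R d).
Local Notation V := 'rV[R]_d.
Local Notation leb := (lebesgue_rV d).
Local Notation L2 := (in_L2 leb Omega).
Local Notation ip := (dotL2s Omega).
Local Notation gp a b := (dotL2 Omega (grad a) (grad b)).

(** Transposition preserves the Frobenius norm, so Young's inequality returns the norm of [F]
    itself. *)
Lemma dotL2_tr_young m (F G : V -> 'M[R]_m) :
  dotL2_finite Omega F F -> dotL2_finite Omega G G ->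
  dotL2_finite Omega (fun x => (F x)^T) G ->
  - (2 * dotL2 Omega (fun x => (F x)^T) G) <= dotL2 Omega F F + dotL2 Omega G G.
Proof.
move=> FF GG FG; have mO := domain_measurable Omega.
rewrite -mulNr /dotL2 -RintegralZl// -RintegralD//; apply: le_Rintegral => //.
- exact: (integrableZl mO (- 2) FG).
- exact: (integrableD mO FF GG).
move=> x _; have -> : Defs.dotmx (F x) (F x) = Defs.dotmx (F x)^T (F x)^T.
  rewrite /Defs.dotmx exchange_big; apply: eq_bigr => i _; apply: eq_bigr => j _.
  by rewrite !mxE.
rewrite /Defs.dotmx mulr_sumr -big_split; apply: ler_sum => i _ /=.
rewrite mulr_sumr -big_split; apply: ler_sum => j _ /=.
set s := (F x)^T i j; set t := G x i j.
by have := sqr_ge0 (s + t); rewrite sqrrD; lra.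
Qed.

(* Testing the difference of two consecutive pressure equations with the
   second increment [x - 2 y + z] of the pressure. *)
Lemma pressure_increment (tau : R) (U W : 'I_d -> H1 Omega) (x y z : H1 Omega) :
  0 < tau -> H10_field U -> H10_field W ->
  mean_zero x -> mean_zero y -> mean_zero z ->
  (forall q : H1 Omega, mean_zero q ->
     tau * gp (x - y) q + ip q (div_field U) = 0) ->
  (forall q : H1 Omega, mean_zero q ->
     tau * gp (y - z) q + ip q (div_field W) = 0) ->
  tau ^+ 2 * gp (x - y - (y - z)) (x - y - (y - z)) <=
  dotL2 Omega (field (U - W)) (field (U - W)).
Proof.
move=> t0 UH WH mx my mz eU eW; set q := x - y - (y - z).
have mq : mean_zero q.
  have B a b : mean_zero a -> mean_zero b -> mean_zero (a - b).
    by move=> ma mb; rewrite -[a]scale1r; exact: mean_zero_lin.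
  by apply: (B); apply: (B).
have := eU q mq; have := eW q mq; rewrite !dotL2s_div_ibp// => eWq eUq.
have FE : field (U - W) = fun X => -1 *: field W X + field U X.
  by apply/funext => X; apply/rowP => i; rewrite !mxE -[LHS]/(U i X - W i X); ring.
have UL := field_in_L2 U; have WL := field_in_L2 W; have qL := grad_in_L2 q.
have L i : L2 (fun X => field (U - W) X 0 i) by exact: field_in_L2.
(* By the difference of the two pressure equations the left-hand side is twice [tau ^+ 2 * gp q q],
   one copy of which is absorbed. *)
have := dotL2_rV_young tau qL L.
have -> : dotL2 Omega (grad q) (field (U - W)) =
    dotL2 Omega (grad q) (field U) - dotL2 Omega (grad q) (field W).
  by rewrite !(dotL2_rVC _ (grad q)) FE dotL2_rV_lin//; ring.
have qE : gp q q = gp (x - y) q - gp (y - z) q by rewrite -dotL2_gradB.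
have -> : dotL2 Omega (grad q) (field U) - dotL2 Omega (grad q) (field W) =
    tau * gp q q by rewrite qE; lra.
by rewrite -mulrA expr2; lra.
Qed.

(** [W] and [U] are the old and new velocities; [x], [y], [z] are the pressures at the new, current
    and previous levels. The term with [tau / T] is the price of the force and feeds the Gronwall
    argument. *)
Lemma energy_step (tau T : R) (nu0 nu1 : V -> R) (F : V -> V)
    (U W : 'I_d -> H1 Omega) (x y z : H1 Omega) :
  d = 2%N \/ d = 3%N -> 0 < tau -> 0 < T ->
  (forall X, (Omega : set V) X -> 0 <= nu1 X) ->
  H10_field U -> H10_field W -> (forall i, L2 (fun X => F X 0 i)) ->
  mean_zero x -> mean_zero y -> mean_zero z ->
  let G0 X := Num.sqrt (nu0 X) *: grad_field W X in
  let G1 X := Num.sqrt (nu1 X) *: grad_field U X in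
  dotL2_finite Omega G0 G0 -> dotL2_finite Omega G1 G1 ->
  dotL2_finite Omega (fun X => Num.sqrt (nu0 X) *: (grad_field W X)^T) G1 ->
  1 / tau * dotL2 Omega (field (U - W)) (field U)
  + dotL2 Omega (fun X => nu1 X *: grad_field U X) (grad_field U)
  + dotL2 Omega (convect U W) (field U)
  + 1 / 2 * dotL2 Omega (fun X => div_field W X *: field U X) (field U)
  = dotL2s Omega (2 *: y - z) (div_field U)
    - dotL2 Omega (fun X => Num.sqrt (nu0 X) *: (grad_field W X)^T) G1
    + dotL2 Omega F (field U) ->
  (forall q : H1 Omega, mean_zero q ->
     tau * gp (x - y) q + ip q (div_field U) = 0) ->
  (forall q : H1 Omega, mean_zero q ->
     tau * gp (y - z) q + ip q (div_field W) = 0) ->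
  normL2 Omega (field U) ^+ 2 +
    (tau * normL2 Omega G1 ^+ 2 + tau ^+ 2 * normL2 Omega (grad x) ^+ 2) <=
  normL2 Omega (field W) ^+ 2 +
    (tau * normL2 Omega G0 ^+ 2 + tau ^+ 2 * normL2 Omega (grad y) ^+ 2) +
  T * (tau * normL2 Omega F ^+ 2) + tau / T * normL2 Omega (field U) ^+ 2.
Proof.
move=> d23 t0 T0 nu1_ge0 UH WH FL mx my mz G0 G1 fin0 fin1 fin01 mom eU eW.
have pinc := pressure_increment t0 UH WH mx my mz eU eW.
have UL := field_in_L2 U; have WL := field_in_L2 W.
(* Testing with the extrapolated pressure expresses the pressure term of the momentum equation
   through gradients. *)
have eq := eU _ (mean_zero_lin 2 my mz).
have skew := convect_skew d23 UH WH.
have cross : - (2 * dotL2 Omega (fun X => Num.sqrt (nu0 X) *: (grad_field W X)^T) G1)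
    <= dotL2 Omega G0 G0 + dotL2 Omega G1 G1.
  have E : (fun X => Num.sqrt (nu0 X) *: (grad_field W X)^T) =
      fun X => (G0 X)^T by apply/funext => X; rewrite /G0 linearZ.
  by rewrite E; apply: dotL2_tr_young => //; rewrite -E.
have visc : dotL2 Omega (fun X => nu1 X *: grad_field U X) (grad_field U) =
    dotL2 Omega G1 G1.
  apply: eq_Rintegral => X /set_mem OX; rewrite /Defs.dotmx.
  apply: eq_bigr => i _; apply: eq_bigr => j _; rewrite /G1 !mxE.
  (* [Num.sqrt] is zero on negative numbers, so nonnegativity of [nu1] on [Omega] matters here. *)
  by rewrite -[in LHS](sqr_sqrtr (nu1_ge0 _ OX)); ring.
have force := dotL2_rV_young T FL UL.
have FE : field (U - W) = fun X => -1 *: field W X + field U X.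
  by apply/funext => X; apply/rowP => i; rewrite !mxE -[LHS]/(U i X - W i X); ring.
have polar : 2 * dotL2 Omega (field (U - W)) (field U) =
    dotL2 Omega (field U) (field U) - dotL2 Omega (field W) (field W) +
    dotL2 Omega (field (U - W)) (field (U - W)).
  by rewrite FE dotL2_rV_sqr_lin// dotL2_rV_lin//; ring.
have gpBr (a b c : H1 Omega) : gp c (a - b) = gp c a - gp c b.
  by rewrite dotL2_gradC dotL2_gradB !(dotL2_gradC c).
(* With [2 y - z = y + (y - z)], this combines the polarisation identities for the pairs [x - y],
   [y] and [x - y], [y - z]. *)
have polar_p : 2 * gp (x - y) (2 *: y - z) = gp x x - gp y y +
    gp (y - z) (y - z) - gp (x - y - (y - z)) (x - y - (y - z)).
  rewrite !gpBr !dotL2_gradB (dotL2_gradC _ (2 *: y)) (dotL2_gradC y (2 *: y)).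
  rewrite !dotL2_gradZ (dotL2_gradC y x) (dotL2_gradC z x) (dotL2_gradC z y).
  ring.
have dyz := dotL2_ge0 Omega (grad (y - z)).
rewrite !normL2_sqr; rewrite visc in mom.
(* All integrals are abstracted into real variables; what remains is arithmetic. *)
move: mom eq skew pinc cross force polar polar_p dyz.
move: (dotL2 Omega (convect U W) _) (dotL2 Omega (fun X => _ *: field U X) _).
move: (dotL2s _ _ _) (gp (x - y) (2 *: y - z)) (gp (y - z) (y - z)).
move: (gp (x - y - (y - z)) _) (dotL2 Omega (field (U - W)) (field U)).
move: (dotL2 Omega (field (U - W)) _) (dotL2 Omega (fun X => _ *: _^T) _).
move: (dotL2 Omega F (field U)) (dotL2 Omega F F) (gp x x) (gp y y).
move: (dotL2 Omega (field U) _) (dotL2 Omega (field W) _).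
move: (dotL2 Omega G0 _) (dotL2 Omega G1 _).
move=> g0 g1 UU WW f FF xx yy D cr pp X q q2 yz c e.
move=> mom eq skew pinc cross force polar polar_p dyz.
have mom2 : 2 * X + 2 * tau * g1 = 2 * tau * q - 2 * tau * cr + 2 * tau * f.
  have -> : 2 * X = 2 * tau * (1 / tau * X) by field; rewrite gt_eqF.
  have -> : 1 / tau * X = q - cr + f - g1 by lra.
  ring.
(* Young's inequality with weight [T], rescaled by [tau / T]. *)
have force2 : 2 * tau * f <= T * (tau * FF) + tau / T * UU.
  have -> : 2 * tau * f = tau / T * (2 * T * f) by field; rewrite gt_eqF.
  have -> : T * (tau * FF) + tau / T * UU = tau / T * (T ^+ 2 * FF + UU).
    by field; rewrite gt_eqF.
  by rewrite ler_wpM2l// divr_ge0// ltW.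
have press : 2 * tau * q = - (tau ^+ 2 * (xx - yy + yz - pp)).
  by rewrite -polar_p (_ : q = - (tau * q2)); [ring|lra].
have cross2 : - (2 * tau * cr) <= tau * (g0 + g1).
  by rewrite (_ : - _ = tau * - (2 * cr)); [rewrite ler_wpM2l// ltW|ring].
have tyz : 0 <= tau ^+ 2 * yz by rewrite mulr_ge0// sqr_ge0.
rewrite !(mulrDr, mulrBr, mulrN, opprD, opprB, opprK) in press cross2 *.
lra.
Qed.

End energy.

(** * Summation over the time steps and the final estimate *)

Theorem theorem4p1 (R : realType) (d : nat) (d23 : d = 2%N \/ d = 3%N)
  (Omega : lipschitz_domain R d) (T : R) (T_gt0 : 0 < T)
  (nu : 'rV[R]_d -> R -> R) (nu_min : R) (nu_min_gt0 : 0 < nu_min)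
  (nu_ge : forall x t, closure Omega x -> 0 <= t <= T -> nu_min <= nu x t)
  (f : 'rV[R]_d -> R -> 'rV[R]_d)
  (f_L2 : forall i, in_L2 (lebesgue_rV d \x lebesgue_measure)%E
     ((Omega : set 'rV[R]_d) `*` `]0, T]%classic) (fun z => f z.1 z.2 0 i))
  (N : nat) (N_ge2 : (2 <= N)%N) (tau : R) (tauE : tau = T / N%:R)
  (fn_L2 : forall n, (1 <= n <= N)%N -> forall i,
     in_L2 (lebesgue_rV d) Omega (fun x => f x (n%:R * tau) 0 i))
  (u : nat -> 'I_d -> H1 Omega) (p : int -> H1 Omega)
  (u_H10 : forall n, (n <= N)%N -> H10_field (u n))
  (u0_div : {ae lebesgue_rV d, forall x, (Omega : set _) x -> div_field (u 0%N) x = 0})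
  (p0E : p 0 = 0) (pN1E : p (-1) = 0)
  (p_mean0 : forall n, (1 <= n <= N)%N -> mean_zero (p n%:Z))
  (* the integrals involving the viscosity are well defined and finite *)
  (nu_norm_fin : forall n, (n <= N)%N ->
     let F := fun x => Num.sqrt (nu x (n%:R * tau)) *: grad_field (u n) x in
     dotL2_finite Omega F F)
  (nu_diff_fin : forall n, (n < N)%N ->
     forall w : 'I_d -> H1 Omega, H10_field w ->
     dotL2_finite Omega
       (fun x => nu x (n.+1%:R * tau) *: grad_field (u n.+1) x)
       (grad_field w))
  (nu_trans_fin : forall n, (n < N)%N ->
     forall w : 'I_d -> H1 Omega, H10_field w ->
     dotL2_finite Omega
       (fun x => Num.sqrt (nu x (n%:R * tau)) *: (grad_field (u n) x)^T)
       (fun x => Num.sqrt (nu x (n.+1%:R * tau)) *: grad_field w x))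
  (momentum : forall n, (n < N)%N ->
     forall w : 'I_d -> H1 Omega, H10_field w ->
     1 / tau * dotL2 Omega (field (u n.+1 - u n)) (field w)
     + dotL2 Omega (fun x => nu x (n.+1%:R * tau) *: grad_field (u n.+1) x)
         (grad_field w)
     + dotL2 Omega (convect (u n.+1) (u n)) (field w)
     + 1 / 2 * dotL2 Omega
         (fun x => div_field (u n) x *: field (u n.+1) x) (field w)
     = dotL2s Omega (2 *: p n%:Z - p (n%:Z - 1)) (div_field w)
       - dotL2 Omega
           (fun x => Num.sqrt (nu x (n%:R * tau)) *: (grad_field (u n) x)^T)
           (fun x => Num.sqrt (nu x (n.+1%:R * tau)) *: grad_field w x)
       + dotL2 Omega (fun x => f x (n.+1%:R * tau)) (field w))
  (pressure : forall n, (n < N)%N -> forall q : H1 Omega, mean_zero q ->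
     tau * dotL2 Omega (grad (p n.+1%:Z - p n%:Z)) (grad q)
     + dotL2s Omega q (div_field (u n.+1)) = 0) :
  let nu_grad n : R :=
    normL2 Omega
      (fun x => Num.sqrt (nu x (n%:R * tau)) *: grad_field (u n) x) in
  let M := expR (1 / (1 - tau / T)) in
  [/\ normL2 Omega (field (u N)) ^+ 2
      + tau * nu_grad N ^+ 2
      + tau ^+ 2 * normL2 Omega (grad (p N%:Z)) ^+ 2
      + tau / T * \sum_(1 <= n < N.+1)
          (tau * nu_grad n ^+ 2
           + tau ^+ 2 * normL2 Omega (grad (p n%:Z)) ^+ 2)
      <= M * (normL2 Omega (field (u 0%N)) ^+ 2
              + tau * nu_grad 0%N ^+ 2
              + T * \sum_(1 <= n < N.+1)
                  tau * normL2 Omega (fun x => f x (n%:R * tau)) ^+ 2),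
      M = expR (N%:R / (N%:R - 1)) &
      M <= expR 1 ^+ 2].
Proof.
move=> nu_grad M.
have N0 : (0 : R) < N%:R by rewrite ltr0n (leq_trans _ N_ge2).
have N1 : (0 : R) < N%:R - 1 by rewrite subr_gt0 ltr1n.
have tau0 : 0 < tau by rewrite tauE divr_gt0.
have tauT : tau / T = N%:R^-1 by rewrite tauE; field; rewrite !gt_eqF.
have ME : M = expR (N%:R / (N%:R - 1)).
  by rewrite /M tauT; congr expR; field; rewrite !gt_eqF.
have time_in n : (n <= N)%N -> 0 <= n%:R * tau <= T.
  move=> nN; rewrite mulr_ge0 ?ler0n ?(ltW tau0)//= tauE mulrA.
  by rewrite ler_pdivrMr// mulrC ler_pM2l// ler_nat.
have pn1 n : p (n.+1%:Z - 1) = p n%:Z by congr p; rewrite -addn1 PoszD addrK.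
have pm1 : p (0%N%:Z - 1) = 0 by rewrite sub0r.
have mp n : (n <= N)%N -> mean_zero (p n%:Z).
  case: n => [_|n nN]; first by rewrite p0E; exact: mean_zero0.
  exact: p_mean0.
have mpV n : (n <= N)%N -> mean_zero (p (n%:Z - 1)).
  case: n => [_|n nN]; first by rewrite pm1; exact: mean_zero0.
  by rewrite pn1; apply: mp; exact: ltnW.
(* The pressure equation one level earlier. At [n = 0] it holds because both initial pressures are
   zero and the initial velocity is divergence free. *)
have pressureV n : (n < N)%N -> forall q : H1 Omega, mean_zero q ->
    tau * dotL2 Omega (grad (p n%:Z - p (n%:Z - 1))) (grad q)
    + dotL2s Omega q (div_field (u n)) = 0.
  case: n => [_|n nN] q mq; last by rewrite pn1; apply: pressure => //; exact: ltnW.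
  rewrite pm1 p0E dotL2_gradB subrr mulr0 add0r.
  by apply: dotL2s_ae0; [exact: H1_in_L2|exact: div_field_in_L2|].
split=> //; last first.
  (* The exponent is at most 2 because [N] is at most [2 (N - 1)] for [N >= 2]. *)
  rewrite ME expr2 -expRD ler_expR ler_pdivrMr//.
  have : (2 : R) <= N%:R by rewrite ler_nat.
  lra.
(* Only the kinetic part [a] is fed back with factor [tau / T]; the viscous and pressure parts go to
   [b], whose sum appears in the estimate. *)
pose a n := normL2 Omega (field (u n)) ^+ 2.
pose b n := tau * nu_grad n ^+ 2 + tau ^+ 2 * normL2 Omega (grad (p n%:Z)) ^+ 2.
pose F n := T * (tau * normL2 Omega (fun x => f x (n%:R * tau)) ^+ 2).
have kN : N%:R * (tau / T) = 1 by rewrite tauT divff// gt_eqF.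
have k0 : 0 < tau / T by rewrite divr_gt0.
have k1 : tau / T < 1 by rewrite tauT invf_lt1// ltr1n.
have b0 n : 0 <= b n.
  by rewrite addr_ge0// mulr_ge0 ?sqr_ge0// ltW.
have F0 n : 0 <= F n.
  exact: (mulr_ge0 (ltW T_gt0) (mulr_ge0 (ltW tau0) (sqr_ge0 _))).
have step n : (n < N)%N -> a n.+1 + b n.+1 <= a n + b n + F n.+1 + tau / T * a n.+1.
  move=> nN; have nN' := ltnW nN.
  have nu_n1 x : (Omega : set 'rV[R]_d) x -> 0 <= nu x (n.+1%:R * tau).
    move=> Ox; apply: le_trans (ltW nu_min_gt0) (nu_ge _ _ _ (time_in _ nN)).
    exact: subset_closure.
  exact: (@energy_step R d Omega tau T (fun x => nu x (n%:R * tau))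
    (fun x => nu x (n.+1%:R * tau)) (fun x => f x (n.+1%:R * tau)) _ _ _ _ _
    d23 tau0 T_gt0 nu_n1 (u_H10 _ nN) (u_H10 _ nN') (fn_L2 n.+1 nN) (mp _ nN)
    (mp _ nN') (mpV _ nN') (nu_norm_fin _ nN') (nu_norm_fin _ nN)
    (nu_trans_fin _ nN _ (u_H10 _ nN)) (momentum _ nN _ (u_H10 _ nN)) (pressure _ nN)
    (pressureV _ nN)).
have := discrete_gronwall k0 k1 kN (fun n => sqr_ge0 _) b0 F0 step.
have -> : \sum_(1 <= n < N.+1) F n = T * \sum_(1 <= n < N.+1)
    tau * normL2 Omega (fun x => f x (n%:R * tau)) ^+ 2 by rewrite mulr_sumr.
rewrite -/M /a /b p0E.
have -> : normL2 Omega (grad (0 : H1 Omega)) ^+ 2 = 0.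
  (* Zero is written as a difference so that linearity of the gradient form makes the norm
     vanish. *)
  rewrite normL2_sqr -[X in grad X](subrr (0 : H1 Omega)).
  by rewrite dotL2_gradB subrr.
by rewrite mulr0 addr0 !addrA.
Qed.
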